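(* Let $0<\alpha\le 1$ and let $\delta,\epsilon,p,q$ be real numbers. Consider the fractional order delay differential equation $$D^\alpha x(t)=\delta x(t-\tau)-\epsilon (x(t-\tau))^3-p(x(t))^2+qx(t)$$ and its equilibrium point $x_2^*=\dfrac{-p+\sqrt{p^2+4\epsilon(\delta+q)}}{2\epsilon}$. If $\epsilon>0$, $p>0$ and $0<-q<\delta<-2q$, then $x_2^*$ is asymptotically stable for all $\tau\ge 0$.
   Context: $D^\alpha$ denotes the Caputo fractional derivative: $D^1x=x'$, and for $0<\alpha<1$, $D^\alpha x(t)=\frac{1}{\Gamma(1-\alpha)}\int_0^t (t-s)^{-\alpha}x'(s)\,ds$. Initial data: $x(t)=\phi(t)$ for $-\tau\le t\le 0$, where $\phi:[-\tau,0]\to\mathbb{R}$; the corresponding solution is denoted $x(t,\phi)$, and $\|\phi\|=\sup_{-\tau\le t\le 0}|\phi(t)|$. (For $\tau=0$ the initial datum is just $x(0)$.) An equilibrium point is a steady state (constant) solution. An equilibrium point $x^*$ is stable if for every $\eta>0$ there is $\rho>0$ such that $\|\phi-x^*\|<\rho$ implies $|x(t,\phi)-x^*|<\eta$ for all $t\ge 0$. It is asymptotically stable if it is stable and there is $b_0>0$ such that $\|\phi-x^*\|<b_0$ implies $\lim_{t\to\infty}x(t,\phi)=x^*$. It is unstable if it is not stable. *)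

(* Defs.v *)
From mathcomp Require Import all_boot all_order all_algebra.
From mathcomp Require Import all_classical all_reals all_analysis.
Set Implicit Arguments.
Unset Strict Implicit.
Unset Printing Implicit Defensive.
Import Order.TTheory GRing.Theory Num.Theory.
Import numFieldNormedType.Exports.
Local Open Scope classical_set_scope.
Local Open Scope ring_scope.

(* Euler's integral; the Gamma function for z > 0. *)
Definition Gamma (R : realType) (z : R) : R :=
  \int[@lebesgue_measure R]_(t in `]0, +oo[) (t `^ (z - 1) * expR (- t)).

Definition caputo (R : realType) (alpha : R) (x : R -> R) (t : R) : R :=
  if alpha == 1 then derive1 x t
  else (Gamma (1 - alpha))^-1 *
       \int[@lebesgue_measure R]_(s in `[0, t])
         ((t - s) `^ (- alpha) * derive1 x s).

(* By Lebesgue's theorem this is absolute continuity of x on [0, b]: the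
   functions for which the x' occurring in the Caputo derivative exists almost
   everywhere and determines x up to a constant. *)
Definition primitive_of_derivative (R : realType) (b : R) (x : R -> R) : Prop :=
  [/\ {ae @lebesgue_measure R, forall t, 0 < t < b -> derivable x t 1},
      (@lebesgue_measure R).-integrable `[0, b] (fun t => (derive1 x t)%:E) &
      forall t, 0 <= t <= b ->
        x t - x 0 = \int[@lebesgue_measure R]_(s in `[0, t]) derive1 x s].

(* x solves D^alpha x(t) = F (x(t)) (x(t - tau)) on [0, T), with T = +oo for a
   global solution, and x = phi on [-tau, 0].  For locally absolutely continuous
   x the integral defining D^alpha x(t) converges for almost every t, and the
   equation is required almost everywhere. *)
Definition solution (R : realType) (alpha tau : R) (F : R -> R -> R)
    (T : \bar R) (phi x : R -> R) : Prop :=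
  [/\ forall s, - tau <= s <= 0 -> x s = phi s,
      forall b : R, 0 < b -> (b%:E < T)%E -> primitive_of_derivative b x &
      {ae @lebesgue_measure R, forall t, 0 < t -> (t%:E < T)%E ->
         caputo alpha x t = F (x t) (x (t - tau))}].

Definition history_norm (R : realType) (tau : R) (phi : R -> R) : \bar R :=
  ereal_sup [set (`|phi s|)%:E | s in `[- tau, 0]%classic].

Definition equilibrium (R : realType) (alpha tau : R) (F : R -> R -> R)
    (c : R) : Prop :=
  solution alpha tau F +oo%E (cst c) (cst c).

(* Ranging over solutions on every interval [0, T), and not only over global
   ones, ensures that solutions blowing up in finite time are not ignored. *)
Definition stable (R : realType) (alpha tau : R) (F : R -> R -> R)
    (c : R) : Prop :=
  equilibrium alpha tau F c /\
  forall eta : R, 0 < eta -> exists2 rho : R, 0 < rho &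
    forall (T : \bar R) (phi x : R -> R), solution alpha tau F T phi x ->
      (history_norm tau (fun s => (phi s - c)%R) < rho%:E)%E ->
      forall t : R, 0 <= t -> (t%:E < T)%E -> `|x t - c| < eta.

Definition asymptotically_stable (R : realType) (alpha tau : R)
    (F : R -> R -> R) (c : R) : Prop :=
  stable alpha tau F c /\
  exists2 b0 : R, 0 < b0 &
    forall phi x : R -> R, solution alpha tau F +oo%E phi x ->
      (history_norm tau (fun s => (phi s - c)%R) < b0%:E)%E ->
      x t @[t --> +oo] --> c.

(* Main.v *)
From HB Require Import structures.
Require Import Defs.
From mathcomp Require Import all_boot all_order all_algebra.
From mathcomp Require Import all_classical all_reals all_analysis.
From mathcomp Require Import measurable_realfun.
From mathcomp Require Import ring lra.
Set Implicit Arguments.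
Unset Strict Implicit.
Unset Printing Implicit Defensive.
Import Order.TTheory GRing.Theory Num.Theory.
Import numFieldNormedType.Exports.
Local Open Scope classical_set_scope.
Local Open Scope ring_scope.

(** Write c for the equilibrium, y = x - c and w for the delayed value of y.
    Since c ^ 2 * epsilon + p * c = delta + q, the equation reads
      D^alpha y = a * w + b * y + terms of order two and three,
      a = delta - 3 * epsilon * c ^ 2,  b = q - 2 * p * c,
    and the hypotheses give |a| < - b: the instantaneous damping dominates the
    delayed feedback, whatever the delay.
    Consequently ([sector_bound]) there are mu > 0 and kappa > 1 such that, for
    small u, the field pushes y back at a rate of at least mu * u as soon as
    |y| lies between u and kappa * u and |w| <= kappa ^ 2 * u.

    This is compared with u(t) = rho * (N / (t + N)) ^ alpha.  For large N the
    function u is so slow that D^alpha u >= - mu * u, with the Caputo memory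
    included ([decay_caputo_ge]), and that it loses at most the factor kappa
    over one delay ([decay_delay]).  If |y| first reached kappa * u at time t0,
    then on [0, t0] the function D^alpha (y - u) would be at most 0 wherever
    y > u, and the same for - y; the maximum principle gives |y| <= u at t0, a
    contradiction.  So |y| <= kappa * u for as long as the solution exists
    ([solution_decay]), which yields stability and attraction at once.

    The maximum principle has to deal with functions that are only primitives
    of integrable functions and with inequalities that hold only almost
    everywhere, so evaluating D^alpha z at a maximum of z is not an option.
    Instead D^alpha z is integrated over the set where z > 0.  Slicing the
    kernel by its values, r ^ - alpha is the integral over m > 0 of the
    indicator of r < theta with theta = m ^ (- 1 / alpha), so that D^alpha z (t)
    is, up to a positive factor, the integral over m of the increments
    z(t) - z(t - theta).  Where z(t) > 0 such an increment is at least the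
    increment of the positive part of z ([positive_part_window_le]); the
    integral over t of the latter is nonnegative because the positive part
    vanishes up to time 0 ([Rintegral_shift_le]), and it is the full integral
    of the positive part when theta exceeds the length of the interval.  Hence
    the integral of D^alpha z over {z > 0} bounds a positive multiple of the
    integral of the positive part from above; if D^alpha z <= 0 there, then
    z <= 0 ([caputo_max_principle_lt1]).  For alpha = 1 the principle is
    elementary ([max_principle_derivative]). *)

(** * The singular kernel and the Gamma function *)

(** The integrand may blow up at both ends, so the fundamental theorem of
    calculus is applied on an exhausting sequence of compact intervals, and
    only an upper bound on the increments of the primitive passes to the
    limit. *)
Lemma ge0_integral_itv_oo_le (R : realType) (f F : R -> R) (a b M : R) :
  (forall x, a < x < b -> 0 <= f x) ->
  (forall x, a < x < b -> {for x, continuous f}) ->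
  (forall x, a < x < b -> is_derive x 1 F (f x)) ->
  (forall x y, a < x -> x <= y -> y < b -> F y - F x <= M) -> 0 <= M ->
  (\int[@lebesgue_measure R]_(x in `]a, b[) (f x)%:E <= M%:E)%E.
Proof.
move=> f0 fc dF FM M0.
pose d n : R := n.+1%:R^-1.
have d0 n : 0 < d n by rewrite invr_gt0.
have dni m n : (m <= n)%N -> d n <= d m.
  by move=> mn; rewrite lef_pV2 ?posrE// ler_nat ltnS.
pose S n : set R := `[a + d n, b - d n]%classic.
have Sab n x : S n x -> a < x < b.
  rewrite /S/= in_itv/= => /andP[h1 h2]; apply/andP; split.
    by rewrite (lt_le_trans _ h1)// ltrDl.
  by rewrite (le_lt_trans h2)// ltrBlDr ltrDl.
have Sbig : `]a, b[%classic = \bigcup_n S n.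
  apply/seteqP; split=> [x|x [n _ /Sab]]; rewrite /= in_itv//= => /andP[ax xb].
  have e0 : 0 < Num.min (x - a) (b - x) by rewrite lt_min !subr_gt0 ax.
  have [n] := ltr_add_invr e0; rewrite add0r lt_min => /andP[h1 h2].
  exists n => //; rewrite /S/= in_itv/=.
  by apply/andP; split; [rewrite -lerBrDl|rewrite lerBrDr -lerBrDl]; exact: ltW.
have fS n : {within S n, continuous f}.
  by apply: continuous_in_subspaceT => x /set_mem /Sab /fc.
rewrite Sbig; apply: cvge_le; last first.
  apply: ge0_nondecreasing_set_cvg_integral => //.
  - move=> m n mn; apply/subsetPset => x; rewrite /S/= !in_itv/=.
    by have := dni _ _ mn => h /andP[h1 h2]; apply/andP; split; lra.
  - by move=> n; exact: measurable_itv.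
  - move=> n; apply/measurable_EFinP; apply: subspace_continuous_measurable_fun => //.
    exact: measurable_itv.
  - by move=> n x /Sab ?; rewrite lee_fin f0.
apply: nearW => n.
have [ab|ba|ab] := ltgtP (a + d n) (b - d n); last 2 first.
- by rewrite /S set_itv_ge ?integral_set0 ?lee_fin// bnd_simp -ltNge.
- by rewrite /S ab set_itv1 integral_set1 lee_fin.
have dFn x : x \in `[a + d n, b - d n] -> is_derive x 1 F (f x).
  by move=> xab; apply: dF; exact: (Sab n).
have Fc x : x \in `[a + d n, b - d n] -> {for x, continuous F}.
  move=> /dFn h; apply: differentiable_continuous; apply/derivable1_diffP.
  exact: ex_derive.
rewrite (@continuous_FTC2 _ f F)//.
- rewrite -EFinB lee_fin FM//.
  + by rewrite ltrDl.
  + exact: ltW.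
  + by rewrite ltrBlDr ltrDl.
- exact: fS.
- split.
  + by move=> x /subset_itv_oo_cc /dFn h; exact: ex_derive.
  + apply: cvg_at_right_filter; apply: Fc; rewrite in_itv/= lexx/=; exact: ltW.
  + apply: cvg_at_left_filter; apply: Fc; rewrite in_itv/= lexx/= andbT; exact: ltW.
- by move=> x /subset_itv_oo_cc /dFn h; rewrite derive1E; exact: derive_val.
exact: eventually_filter.
Qed.

Lemma is_derive_powR_sub (R : realType) (a c x : R) : a < x ->
  is_derive x 1 (fun s => (s - a) `^ c) (c * (x - a) `^ (c - 1)).
Proof.
move=> ax.
have h : is_derive (x - a) (1:R) (@powR R ^~ c) (c * (x - a) `^ (c - 1)).
  by apply: is_derive1_powR; rewrite subr_gt0.
have hs : is_derive x (1:R) (fun s : R => s - a) 1.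
  by rewrite -[X in is_derive _ _ _ X]subr0; apply: is_deriveB.
by have := @is_derive1_comp _ (@powR R ^~ c) (fun s => s - a) x _ _ h hs; rewrite mulr1.
Qed.

Lemma is_derive_powR_subr (R : realType) (a c x : R) : x < a ->
  is_derive x 1 (fun s => (a - s) `^ c) (- (c * (a - x) `^ (c - 1))).
Proof.
move=> xa.
have h : is_derive (a - x) (1:R) (@powR R ^~ c) (c * (a - x) `^ (c - 1)).
  by apply: is_derive1_powR; rewrite subr_gt0.
have hs : is_derive x (1:R) (fun s : R => a - s) (- 1).
  by rewrite -[X in is_derive _ _ _ X]sub0r; apply: is_deriveB.
by have := @is_derive1_comp _ (@powR R ^~ c) (fun s => a - s) x _ _ h hs; rewrite mulrN1.
Qed.

Lemma is_derive1_continuous (R : realType) (f : R -> R) (x df : R) :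
  is_derive x 1 f df -> {for x, continuous f}.
Proof.
move=> h; apply: differentiable_continuous; apply/derivable1_diffP.
exact: ex_derive.
Qed.

Lemma integral_powR_sub_le (R : realType) (alpha a b : R) :
  alpha < 1 -> a <= b ->
  (\int[@lebesgue_measure R]_(x in `]a, b[) ((x - a) `^ (- alpha))%:E
     <= ((1 - alpha)^-1 * (b - a) `^ (1 - alpha))%:E)%E.
Proof.
move=> a1 ab; have a1' : 0 < 1 - alpha by rewrite subr_gt0.
apply: (@ge0_integral_itv_oo_le R (fun x => (x - a) `^ (- alpha))
   (fun x => (1 - alpha)^-1 * (x - a) `^ (1 - alpha))).
- by move=> x _; exact: powR_ge0.
- move=> x /andP[ax _]; exact: (is_derive1_continuous (is_derive_powR_sub (- alpha) ax)).
- move=> x /andP[ax _]; have /= := is_deriveZ (1 - alpha)^-1 (is_derive_powR_sub (1 - alpha) ax).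
  rewrite /GRing.scale/= mulrA mulVf ?gt_eqF// mul1r.
  by rewrite (_ : 1 - alpha - 1 = - alpha)//; ring.
- move=> x y ax xy yb; rewrite -mulrBr ler_pM2l ?invr_gt0//.
  rewrite (le_trans _ (_ : (y - a) `^ (1 - alpha) <= _))//.
    by rewrite gerBl powR_ge0.
  by rewrite ge0_ler_powR ?nnegrE ?subr_ge0 ?lerB// ltW// (lt_le_trans ax).
- by rewrite mulr_ge0 ?powR_ge0// invr_ge0 ltW.
Qed.

Lemma integral_powR_subr_le (R : realType) (alpha a b : R) :
  alpha < 1 -> a <= b ->
  (\int[@lebesgue_measure R]_(x in `]a, b[) ((b - x) `^ (- alpha))%:E
     <= ((1 - alpha)^-1 * (b - a) `^ (1 - alpha))%:E)%E.
Proof.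
move=> a1 ab; have a1' : 0 < 1 - alpha by rewrite subr_gt0.
apply: (@ge0_integral_itv_oo_le R (fun x => (b - x) `^ (- alpha))
   (fun x => - (1 - alpha)^-1 * (b - x) `^ (1 - alpha))).
- by move=> x _; exact: powR_ge0.
- move=> x /andP[_ xb]; exact: (is_derive1_continuous (is_derive_powR_subr (- alpha) xb)).
- move=> x /andP[_ xb]; have /= := is_deriveZ (- (1 - alpha)^-1) (is_derive_powR_subr (1 - alpha) xb).
  rewrite /GRing.scale/= mulrNN mulrA mulVf ?gt_eqF// mul1r.
  by rewrite (_ : 1 - alpha - 1 = - alpha)//; ring.
- move=> x y ax xy yb; rewrite !mulNr opprK addrC -mulrBr ler_pM2l ?invr_gt0//.
  rewrite (le_trans _ (_ : (b - x) `^ (1 - alpha) <= _))//.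
    by rewrite gerBl powR_ge0.
  rewrite ge0_ler_powR ?nnegrE ?subr_ge0 ?lerB// ltW// (le_lt_trans xy)//.
- by rewrite mulr_ge0 ?powR_ge0// invr_ge0 ltW.
Qed.

Lemma integral_expRN_cy (R : realType) :
  (\int[@lebesgue_measure R]_(t in `[1%R, +oo[) (expR (- t))%:E = (expR (- 1)%R)%:E)%E.
Proof.
have dE (x : R) : is_derive x 1 (fun t : R => - expR (- t)) (expR (- x)).
  have h : is_derive x (1:R) (fun s : R => - s) (- 1) by apply: is_deriveN.
  have := is_deriveN (@is_derive1_comp _ expR (fun s => - s) x _ _ (is_derive_expR _) h).
  by rewrite mulrN1 opprK.
rewrite (@ge0_continuous_FTC2y _ (fun t => expR (- t)) (fun t => - expR (- t)) 1 0).
- by rewrite sub0e -EFinN opprK.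
- by move=> x _; exact: expR_ge0.
- apply: continuous_subspaceT => x.
  by apply: continuous_comp; [exact: opp_continuous|exact: continuous_expR].
- rewrite -[X in _ --> X]oppr0; apply: cvgN.
  by have := @cvgr_expR R.
- by move=> x _; exact: ex_derive.
- by apply: cvg_at_right_filter; exact: (is_derive1_continuous (dE 1)).
- by move=> x _; rewrite derive1E; exact: derive_val.
Qed.

(** Rules out the degenerate case in which Euler's integral diverges and its
    real value is 0, which would make the Caputo derivative vanish identically. *)
Lemma Gamma_gt0 (R : realType) (alpha : R) : 0 < alpha < 1 ->
  0 < Gamma (1 - alpha).
Proof.
move=> /andP[a0 a1]; rewrite /Gamma /Rintegral.
rewrite (_ : 1 - alpha - 1 = - alpha); last by ring.
set f := fun t : R => t `^ (- alpha) * expR (- t).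
have f0 t : 0 <= f t by rewrite mulr_ge0 ?powR_ge0 ?expR_ge0.
have mexp : measurable_fun setT (fun t : R => expR (- t)).
  by apply: measurableT_comp => //; exact: measurable_oppr.
have mf : measurable_fun setT f by apply: measurable_funM.
have mfE D : measurable_fun D (fun t => (f t)%:E).
  by apply/measurable_EFinP; exact: measurable_funTS.
change (0 < fine (\int[@lebesgue_measure R]_(t in `]0%R, +oo[) (f t)%:E)%E).
apply: fine_gt0; apply/andP; split.
- have h01 : (\int[@lebesgue_measure R]_(t in `]0%R, 1%R[) (expR (- 1))%:E <=
    \int[@lebesgue_measure R]_(t in `]0%R, +oo[) (f t)%:E)%E.
    apply: (@le_trans _ _ (\int[@lebesgue_measure R]_(t in `]0%R, 1%R[) (f t)%:E)%E).
      apply: ge0_le_integral => //.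
      - exact: mfE.
      - move=> x; rewrite /= in_itv/= => /andP[x0 x1]; rewrite lee_fin /f.
        rewrite -[leLHS]mul1r ler_pM ?expR_ge0//.
          by rewrite -(powRr0 x) ger_powR ?x0 ?oppr_le0 ?ltW.
        by rewrite ler_expR lerN2 ltW.
    apply: ge0_subset_integral => //.
    - exact: mfE.
    - by move=> x _; rewrite lee_fin f0.
    - by move=> x; rewrite /= !in_itv/= => /andP[-> _].
  apply: lt_le_trans h01.
  rewrite integral_cst//= lebesgue_measure_itv/= lte_fin ltr01 -EFinB subr0 mule1.
  by rewrite lte_fin expR_gt0.
- have -> : `]0%R, +oo[%classic = `]0, 1[%classic `|` `[1, +oo[%classic :> set R.
    apply/seteqP; split => x /=; rewrite !in_itv/= ?andbT.
      by move=> x0; case: (ltP x 1) => h; [left; rewrite x0|right].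
    by case=> [/andP[]//|]; exact: lt_le_trans.
  rewrite ge0_integral_setU//=; last 3 first.
  - exact: mfE.
  - by move=> x _; rewrite lee_fin f0.
  - by rewrite disj_set2E; apply/eqP/seteqP; split => x //=;
      rewrite !in_itv/= => -[/andP[_ h]]; rewrite leNgt h.
  apply: lte_add_pinfty.
  + apply: (@le_lt_trans _ _ ((1 - alpha)^-1 * (1 - 0) `^ (1 - alpha))%:E); last exact: ltry.
    apply: le_trans (integral_powR_sub_le a1 ler01).
    apply: ge0_le_integral => //.
    * by move=> x _; rewrite lee_fin f0.
    * exact: mfE.
    * apply/measurable_EFinP; apply: measurable_funTS.
      by apply: (@measurableT_comp _ _ _ _ _ _ (@powR R ^~ (- alpha))) => //; exact: measurable_funD.
    * move=> x; rewrite /= in_itv/= => /andP[x0 x1]; rewrite lee_fin /f subr0.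
      by rewrite ler_piMr ?powR_ge0// -expR0 ler_expR oppr_le0 ltW.
  + apply: (@le_lt_trans _ _ (expR (- 1))%:E); last exact: ltry.
    rewrite -integral_expRN_cy; apply: ge0_le_integral => //.
    * by move=> x _; rewrite lee_fin f0.
    * exact: mfE.
    * by apply/measurable_EFinP; exact: measurable_funTS.
    * move=> x; rewrite /= in_itv/= andbT => x1; rewrite lee_fin /f.
      by rewrite ler_piMl ?expR_ge0// -(powRr0 x) ler_powR// oppr_le0 ltW.
Qed.

(** * Measure-theoretic tools *)

Lemma ae_lebesgue_mp2 (R : realType) (P Q S : R -> Prop) :
  (forall t, P t -> Q t -> S t) ->
  {ae @lebesgue_measure R, forall t, P t} ->
  {ae @lebesgue_measure R, forall t, Q t} ->
  {ae @lebesgue_measure R, forall t, S t}.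
Proof.
move=> PQS aeP aeQ.
have F : Filter (almost_everywhere (@lebesgue_measure R)).
  exact: ae_filter_ringOfSetsType.
exact: (filterS2 _ PQS aeP aeQ).
Qed.

Lemma ae_lebesgue_mp (R : realType) (P Q : R -> Prop) :
  (forall t, P t -> Q t) ->
  {ae @lebesgue_measure R, forall t, P t} ->
  {ae @lebesgue_measure R, forall t, Q t}.
Proof. by move=> PQ aeP; apply: (ae_lebesgue_mp2 _ aeP aeP) => t Pt _; exact: PQ. Qed.

Lemma integrable_patch (d : measure_display) (T : measurableType d)
    (R : realType) (m : {measure set T -> \bar R}) (D : set T) (f : T -> R) :
  measurable D -> m.-integrable D (EFin \o f) ->
  m.-integrable setT (EFin \o (f \_ D)).
Proof. by move=> mD /(integrable_mkcond _ mD); rewrite restrict_EFin. Qed.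

Lemma RintegralN (d : measure_display) (T : measurableType d)
    (R : realType) (m : {measure set T -> \bar R}) (D : set T) (f : T -> R) :
  measurable D -> m.-integrable D (EFin \o f) ->
  \int[m]_(x in D) - f x = - \int[m]_(x in D) f x.
Proof.
move=> mD fi; under eq_Rintegral do rewrite -mulN1r.
by rewrite RintegralZl// mulN1r.
Qed.

Lemma eq_indic (T T' : Type) (R : pzRingType) (A : set T) (B : set T') x y :
  (A x <-> B y) -> \1_A x = \1_B y :> R.
Proof.
by move=> AB; rewrite !indicE; congr (_%:R); congr nat_of_bool; exact/asbool_equiv_eq.
Qed.

Lemma integral_indicM (d : measure_display) (T : measurableType d)
    (R : realType) (m : {measure set T -> \bar R}) (A : set T) (f : T -> R) :
  (\int[m]_x (\1_A x * f x)%:E = \int[m]_(x in A) (f x)%:E)%E.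
Proof.
rewrite [RHS]integral_mkcond; apply: eq_integral => x _.
by rewrite patchE indicE; case: ifPn => _; rewrite ?mul1r ?mul0r.
Qed.

Lemma integral_ae_le0 (d : measure_display) (T : measurableType d)
    (R : realType) (m : {measure set T -> \bar R}) (D : set T) (f : T -> \bar R) :
  measurable D -> measurable_fun D f ->
  {ae m, forall x, D x -> (f x <= 0)%E} -> (\int[m]_(x in D) f x <= 0)%E.
Proof.
move=> mD mf f0; rewrite integralE.
have -> : (\int[m]_(x in D) f^\+ x = \int[m]_(x in D) cst 0 x)%E.
  apply: ge0_ae_eq_integral => //; first exact: measurable_funepos.
  by apply: filterS f0 => x fx Dx; rewrite /= funeposE; exact/max_r/fx.
by rewrite integral0 sub0e oppe_le0 integral_ge0.
Qed.

Lemma continuous_integrable_itv_oo (R : realType) (f : R -> R) (a b : R) :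
  continuous f -> (@lebesgue_measure R).-integrable `]a, b[ (EFin \o f).
Proof.
move=> fc; have : (@lebesgue_measure R).-integrable `[a, b] (EFin \o f).
  apply: continuous_compact_integrable; first exact: segment_compact.
  exact: continuous_subspaceT.
by apply: integrableS => //; exact: subset_itv_oo_cc.
Qed.

Lemma measurable_set_lt (d : measure_display) (T : measurableType d)
    (R : realType) (f g : T -> R) :
  measurable_fun setT f -> measurable_fun setT g ->
  measurable [set p | f p < g p].
Proof.
move=> mf mg; rewrite -[X in measurable X]setTI.
exact: (measurable_fun_ltr mf mg measurableT (_ : measurable [set true])).
Qed.

(** Makes the plane eligible as a factor of a further product with the line of
    kernel levels. *)
Lemma product_measure1_sigma_finite (d1 d2 : measure_display)
  (T1 : measurableType d1) (T2 : measurableType d2) (R : realType)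
  (m1 : {sigma_finite_measure set T1 -> \bar R})
  (m2 : {sigma_finite_measure set T2 -> \bar R}) :
  sigma_finite setT (m1 \x m2)%E.
Proof.
have /sigma_finiteP[F [TF ndF Foo]] := sigma_finiteT m1.
have /sigma_finiteP[G [TG ndG Goo]] := sigma_finiteT m2.
exists (fun n => F n `*` G n); last first.
  move=> n; have [mF Fn] := Foo n; have [mG Gn] := Goo n; split.
    exact: measurableX.
  by rewrite [ltLHS]product_measure1E// lte_mul_pinfty// ge0_fin_numE.
apply/seteqP; split=> // -[x y] _.
have [m _ Fm] : (\bigcup_i F i) x by rewrite -TF.
have [n _ Gn] : (\bigcup_i G i) y by rewrite -TG.
exists (maxn m n) => //; split => /=.
  by move: x Fm; apply/subsetPset/ndF/leq_maxl.
by move: y Gn; apply/subsetPset/ndG/leq_maxr.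
Qed.

Section product_sigma_finite.
Context (d1 d2 : measure_display) (T1 : measurableType d1)
  (T2 : measurableType d2) (R : realType)
  (m1 : {sigma_finite_measure set T1 -> \bar R})
  (m2 : {sigma_finite_measure set T2 -> \bar R}).
Let m12 := (m1 \x m2)%E.

HB.instance Definition _ := Measure.on m12.
HB.instance Definition _ := @Measure_isSigmaFinite.Build _ _ _ m12
  (product_measure1_sigma_finite m1 m2).

Definition product_sigma_finite :
  {sigma_finite_measure set (T1 * T2)%type -> \bar R} := m12.

End product_sigma_finite.

Lemma integrable_fubini_G (d1 d2 : measure_display) (T1 : measurableType d1)
    (T2 : measurableType d2) (R : realType)
    (m1 : {sigma_finite_measure set T1 -> \bar R})
    (m2 : {sigma_finite_measure set T2 -> \bar R}) (f : T1 * T2 -> \bar R) :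
  (m1 \x m2)%E.-integrable setT f ->
  m2.-integrable setT (fubini_G m1 f).
Proof.
move=> fi; have mf := measurable_int _ fi.
apply/integrableP; split; first exact: (measurable_fubini_G fi).
have /(integrable21ltyP _ _ mf) := fi; apply: le_lt_trans.
apply: ge0_le_integral => //.
- by apply: measurableT_comp => //; exact: (measurable_fubini_G fi).
- apply: (@measurable_fun_fubini_tonelli_G _ _ _ _ R m1 (fun p => `|f p|%E)) => //.
  exact: measurableT_comp.
- move=> y _; apply: le_abse_integral => //.
  by apply: (measurableT_comp mf); exact: measurable_pair2.
Qed.

(** Writing [k p] as the length of the interval of levels below it and exchanging
    the two integrations turns a weighted integral of a signed function into an
    integral over the levels of its integrals over the superlevel sets. *)
Lemma layer_cake_fubini (d : measure_display) (T : measurableType d)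
    (R : realType) (m : {sigma_finite_measure set T -> \bar R}) (A k : T -> R) :
  measurable_fun setT A -> measurable_fun setT k -> (forall p, 0 <= k p) ->
  m.-integrable setT (fun p => (k p * A p)%:E) ->
  let Psi (q : T * R) :=
    (\1_[set q : T * R | 0 < q.2 /\ q.2 < k q.1] q * A q.1)%:E in
  (m \x @lebesgue_measure R)%E.-integrable setT Psi /\
  (\int[m]_p (k p * A p)%:E =
   \int[@lebesgue_measure R]_c \int[m]_p Psi (p, c))%E.
Proof.
move=> mA mk k0 ikA Psi.
pose S := [set q : T * R | 0 < q.2 /\ q.2 < k q.1].
have mS : measurable S.
  apply: measurableI; apply: measurable_set_lt => //.
  exact: (@measurableT_comp _ _ _ _ _ _ k).
have mPsi : measurable_fun setT Psi.
  apply/measurable_EFinP; apply: measurable_funM.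
    exact: measurable_indic.
  exact: (@measurableT_comp _ _ _ _ _ _ A).
have SE p c : \1_S (p, c) = \1_(`]0, k p[%classic : set R) c :> R.
  by apply: eq_indic; rewrite /S /= in_itv/=; split=> [[-> ->]|/andP[]].
have Ik (p : T) (a : R) :
    (\int[@lebesgue_measure R]_c (\1_(`]0, k p[%classic : set R) c * a)%:E = (k p * a)%:E)%E.
  rewrite integral_indicM integral_cst//= lebesgue_measure_itv/= lte_fin.
  case: ltP => kp; first by rewrite -EFinB subr0 -EFinM mulrC.
  by rewrite mule0 (_ : k p = 0) ?mul0r//; apply/eqP; rewrite eq_le kp k0.
have iPsi : (m \x @lebesgue_measure R)%E.-integrable setT Psi.
  apply/integrable12ltyP => //; case/integrableP: ikA => _.
  apply: le_lt_trans; rewrite le_eqVlt; apply/orP; left; apply/eqP.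
  apply: eq_integral => p _; rewrite /= normrM (ger0_norm (k0 p)) -Ik.
  apply: eq_integral => c _; rewrite /Psi -/S SE /= normrM ger0_norm//.
split=> //.
rewrite -(Fubini iPsi); apply: eq_integral => p _.
by rewrite -Ik; apply: eq_integral => c _; rewrite /Psi -/S SE.
Qed.

(** * Primitives of integrable functions *)

Lemma Rintegral_itv_bndoo (R : realType) (a b : R) (b0 b1 : bool) (f : R -> R) :
  measurable_fun `]a, b[ f ->
  \int[@lebesgue_measure R]_(x in [set` Interval (BSide b0 a) (BSide b1 b)]) f x =
  \int[@lebesgue_measure R]_(x in `]a, b[) f x.
Proof.
by move=> mf; rewrite /Rintegral integral_itv_bndoo//; exact/measurable_EFinP.
Qed.

Lemma Rintegral_itv_oo_cat (R : realType) (H : R -> R) (a c x : R) :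
  (@lebesgue_measure R).-integrable setT (EFin \o H) -> a <= c -> c <= x ->
  \int[@lebesgue_measure R]_(s in `]a, x[) H s =
  \int[@lebesgue_measure R]_(s in `]a, c[) H s +
  \int[@lebesgue_measure R]_(s in `]c, x[) H s.
Proof.
move=> iH ac cx.
have iHD (D : set R) : measurable D -> (@lebesgue_measure R).-integrable D (EFin \o H).
  by move=> mD; apply: integrableS iH.
have mH D : measurable_fun D H.
  apply: (@measurable_funTS _ _ _ _ D H); apply/measurable_EFinP; exact: measurable_int iH.
have := @Rintegral_itvB R H (BRight a) (BRight x) c.
rewrite !bnd_simp => /(_ (iHD _ (measurable_itv _)) ac cx).
by rewrite !Rintegral_itv_bndoo// => <-; rewrite addrC subrK.
Qed.

Lemma Rintegral_itv_oo_continuous (R : realType) (H : R -> R) (a : R) :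
  (@lebesgue_measure R).-integrable setT (EFin \o H) ->
  continuous (fun x => \int[@lebesgue_measure R]_(s in `]a, x[) H s).
Proof.
move=> iH.
have iHD (D : set R) : measurable D -> (@lebesgue_measure R).-integrable D (EFin \o H).
  by move=> mD; apply: integrableS iH.
have mH D : measurable_fun D H.
  apply: (@measurable_funTS _ _ _ _ D H); apply/measurable_EFinP; exact: measurable_int iH.
pose F x := \int[@lebesgue_measure R]_(s in `[a - 1, x]) H s.
have Fc x : a - 1 < x -> {for x, continuous F}.
  move=> ax; have := @parameterized_integral_continuous R (a - 1) (x + 1) H.
  have ax1 : a - 1 <= x + 1 by lra.
  move=> /(_ ax1 (iHD _ (measurable_itv _))).
  move/continuous_within_itvP => /(_ _)[|+ _ _]; first lra.
  by move=> /(_ x); apply; rewrite in_itv/= ax ltrDl ltr01.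
have -> : (fun x => \int[@lebesgue_measure R]_(s in `]a, x[) H s) =
    (fun x => F (Num.max x a) - F a).
  apply/funext => x; rewrite /F !Rintegral_itv_bndoo//.
  rewrite (@Rintegral_itv_oo_cat _ H (a - 1) a (Num.max x a))//; last 2 first.
  - by rewrite gerBl ler01.
  - by rewrite le_max lexx orbT.
  rewrite addrC addKr; have [//|xa] := leP a x.
  by rewrite !set_itv_ge ?Rintegral_set0// -leNgt bnd_simp// ltW.
move=> x; rewrite /continuous_at; apply: cvgB; last exact: cvg_cst.
apply: (@continuous_comp _ _ _ (fun x => Num.max x a) F x).
  by apply: continuous_max; [exact: cvg_id|exact: cvg_cst].
by apply: Fc; rewrite lt_max; apply/orP; right; rewrite ltrBlDr ltrDl ltr01.
Qed.

(** Defined on the whole line and equal to [z0] up to time 0, so that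
    shifted values need no truncation. *)
Definition primitive_oo (R : realType) (z0 : R) (H : R -> R) (t : R) : R :=
  z0 + \int[@lebesgue_measure R]_(s in `]0, t[) H s.

Lemma primitive_oo_continuous (R : realType) (z0 : R) (H : R -> R) :
  (@lebesgue_measure R).-integrable setT (EFin \o H) ->
  continuous (primitive_oo z0 H).
Proof.
by move=> iH t; apply: cvgD; [exact: cvg_cst|exact: Rintegral_itv_oo_continuous].
Qed.

Lemma primitive_oo_le0 (R : realType) (z0 : R) (H : R -> R) (t : R) :
  t <= 0 -> primitive_oo z0 H t = z0.
Proof.
by move=> t0; rewrite /primitive_oo set_itv_ge ?Rintegral_set0 ?addr0// bnd_simp -leNgt.
Qed.

Lemma primitive_oo_patch (R : realType) (z0 : R) (h : R -> R) (b t : R) :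
  t <= b -> primitive_oo z0 (h \_ `]0, b[) t = primitive_oo z0 h t.
Proof.
move=> tb; congr (_ + _); apply: eq_Rintegral => s.
rewrite inE/= in_itv/= => /andP[s0 st].
by rewrite patchE mem_set//= in_itv/= s0 (lt_le_trans st tb).
Qed.

Lemma primitive_ooB (R : realType) (z0 : R) (H : R -> R) (a t : R) :
  (@lebesgue_measure R).-integrable setT (EFin \o H) -> 0 <= a -> a <= t ->
  primitive_oo z0 H t - primitive_oo z0 H a =
  \int[@lebesgue_measure R]_(s in `]a, t[) H s.
Proof.
move=> iH a0 at_; rewrite /primitive_oo opprD addrACA subrr add0r.
by rewrite (Rintegral_itv_oo_cat iH a0 at_) addrAC subrr add0r.
Qed.

(** * The Caputo maximum principle *)

Definition subdiag (R : realType) (b : R) : set (R * R) :=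
  [set p | 0 < p.2 /\ p.2 < p.1 /\ p.1 < b].

Lemma measurable_subdiag (R : realType) (b : R) :
  measurable (subdiag b).
Proof.
by apply: measurableI; [|apply: measurableI]; exact: measurable_set_lt.
Qed.

Lemma measurable_diff_powR (R : realType) (a : R) :
  measurable_fun setT (fun p : R * R => (p.1 - p.2) `^ a).
Proof.
apply: (@measurableT_comp _ _ _ _ _ _ (@powR R ^~ a)) => //.
exact: measurable_funB.
Qed.

Lemma measurable_kernel (R : realType) (alpha t : R) :
  measurable_fun setT (fun s : R => (t - s) `^ (- alpha)).
Proof.
apply: (@measurableT_comp _ _ _ _ _ _ (@powR R ^~ (- alpha))) => //.
exact: measurable_funB.
Qed.

(** By Tonelli: for fixed [s] the kernel integrates over [t] to at most
    [b ^ (1 - alpha) / (1 - alpha)], because [alpha < 1]. *)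
Lemma kernel_integrable (R : realType) (alpha b : R) (H : R -> R) :
  alpha < 1 -> 0 < b -> (@lebesgue_measure R).-integrable setT (EFin \o H) ->
  (@lebesgue_measure R \x @lebesgue_measure R)%E.-integrable setT
    (fun p => (\1_(subdiag b) p * ((p.1 - p.2) `^ (- alpha) * H p.2))%:E).
Proof.
move=> a1 b0 iH.
have mH : measurable_fun setT H by apply/measurable_EFinP; exact: measurable_int iH.
have mF : measurable_fun setT (fun p : R * R =>
    (\1_(subdiag b) p * ((p.1 - p.2) `^ (- alpha) * H p.2))%:E).
  apply/measurable_EFinP; apply: measurable_funM.
    exact: measurable_indic (measurable_subdiag b).
  by apply: measurable_funM; [exact: measurable_diff_powR|exact: measurableT_comp].
apply/integrable21ltyP => //.
pose C := (1 - alpha)^-1 * b `^ (1 - alpha).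
have C0 : 0 <= C by rewrite mulr_ge0 ?powR_ge0// invr_ge0 subr_ge0 ltW.
apply: (@le_lt_trans _ _ (\int[@lebesgue_measure R]_y (C%:E * (`|H y|)%:E))%E); last first.
  rewrite ge0_integralZl_EFin//; last first.
    by apply/measurable_EFinP; exact: measurableT_comp.
  by rewrite lte_mul_pinfty//; case/integrableP: iH.
apply: ge0_le_integral => //.
- by move=> y _; exact: integral_ge0.
- apply: (@measurable_fun_fubini_tonelli_G _ _ _ _ R (@lebesgue_measure R)
    (fun p => `|(\1_(subdiag b) p * ((p.1 - p.2) `^ (- alpha) * H p.2))%:E|%E)) => //.
  exact: measurableT_comp.
- apply/measurable_EFinP; apply: measurable_funM => //; exact: measurableT_comp.
- move=> y _ /=.
  have [y0|y0] := leP y 0.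
    rewrite integral0_eq ?mule_ge0// => x _ /=.
    by rewrite indicE memNset ?mul0r ?normr0// /subdiag/= => -[]; rewrite ltNge y0.
  have [yb|yb] := leP b y.
    rewrite integral0_eq ?mule_ge0// => x _ /=.
    rewrite indicE memNset ?mul0r ?normr0// /subdiag/= => -[_ [yx xb]].
    by have := lt_trans yx xb; rewrite ltNge yb.
  have -> : (\int[@lebesgue_measure R]_x
      `|(\1_(subdiag b) (x, y) * ((x - y) `^ (- alpha) * H y))%:E| =
      \int[@lebesgue_measure R]_x ((`|H y|)%:E *
        (\1_(`]y, b[) x * (x - y) `^ (- alpha))%:E))%E.
    apply: eq_integral => x _ /=; rewrite -EFinM; congr EFin.
    have -> : \1_(subdiag b) (x, y) = \1_(`]y, b[%classic : set R) x :> R.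
      apply: eq_indic; rewrite /subdiag/= in_itv/=.
      by split=> [[_ [-> ->]]|/andP[]].
    by rewrite indicE !normrM normr_nat (ger0_norm (powR_ge0 _ _)); ring.
  rewrite ge0_integralZl_EFin//; last 2 first.
  - by move=> x _; rewrite lee_fin mulr_ge0 ?powR_ge0// indicE.
  - apply/measurable_EFinP; apply: measurable_funM.
      exact: measurable_indic (measurable_itv _).
    apply: (@measurableT_comp _ _ _ _ _ _ (@powR R ^~ (- alpha))) => //.
    exact: measurable_funD.
  rewrite muleC lee_wpmul2r// integral_indicM.
  apply: le_trans (integral_powR_sub_le a1 (ltW yb)) _.
  rewrite lee_fin ler_pM2l ?invr_gt0 ?subr_gt0//.
  by rewrite ge0_ler_powR ?nnegrE ?subr_ge0 ?gerBl// ltW.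
Qed.

(** The Caputo integral of an integrable function need not converge
    everywhere; it does almost everywhere, which is enough for linearity. *)
Lemma kernel_ae_integrable (R : realType) (alpha b : R) (h : R -> R) :
  alpha < 1 -> 0 < b ->
  (@lebesgue_measure R).-integrable `]0, b[ (EFin \o h) ->
  {ae @lebesgue_measure R, forall t, 0 < t < b ->
    (@lebesgue_measure R).-integrable `]0, t[
      (fun s => ((t - s) `^ (- alpha) * h s)%:E)}.
Proof.
move=> a1 b0 ih.
have iH : (@lebesgue_measure R).-integrable setT (EFin \o (h \_ `]0, b[)).
  exact: integrable_patch.
apply: filterS (ae_integrable1 (kernel_integrable a1 b0 iH)) => t it /andP[t0 tb].
rewrite integrable_mkcond//.
apply: eq_integrable it => // s _ /=.
have -> : \1_(subdiag b) (t, s) = \1_(`]0, t[%classic : set R) s :> R.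
  apply: eq_indic; rewrite /subdiag /= in_itv/=; split=> [[-> [-> _]]//|/andP[-> ->]].
  by split=> //; split.
rewrite [RHS]patchE indicE; case: ifPn => [|_]; last by rewrite mul0r.
rewrite inE/= in_itv/= => /andP[s0 st].
by rewrite mul1r patchE mem_set//= in_itv/= s0 (lt_trans st tb).
Qed.

(** Identifies the superlevel sets of the kernel as windows. *)
Lemma lt_powRN (R : realType) (alpha c r : R) : 0 < alpha -> 0 < c -> 0 < r ->
  (c < r `^ (- alpha)) = (r < c `^ (- alpha^-1)).
Proof.
move=> a0 c0 r0.
have key (x y : R) : 0 < x -> 0 < y -> forall d, 0 < d -> x < y `^ (- d) -> y < x `^ (- d^-1).
  move=> x0 y0 d d0 h.
  have := gt0_ltr_powR (_ : 0 < d^-1) _ _ h; rewrite invr_gt0 !nnegrE => /(_ d0 (ltW x0) (powR_ge0 _ _)).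
  rewrite -powRrM mulNr divff ?gt_eqF// powR_inv1 ?ltW// powRN => h2.
  by rewrite -[ltLHS]invrK ltf_pV2 ?posrE ?invr_gt0 ?powR_gt0.
apply/idP/idP => h; first exact: key.
have := key r c r0 c0 alpha^-1; rewrite invrK invr_gt0; exact.
Qed.

(** The shift moves mass to the left of 0, where [v] vanishes, or out of the
    interval on the right. *)
Lemma Rintegral_shift_le (R : realType) (v : R -> R) (b theta : R) :
  continuous v -> (forall t, 0 <= v t) -> (forall t, t <= 0 -> v t = 0) ->
  0 < b -> 0 < theta ->
  \int[@lebesgue_measure R]_(t in `]0, b[) v (t - theta) <=
  \int[@lebesgue_measure R]_(t in `]0, b[) v t.
Proof.
move=> vc v0 vz b0 th0.
have mv : measurable_fun setT v by exact: continuous_measurable_fun.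
have vcW (a c : R) : {within `[a, c], continuous v} by exact: continuous_subspaceT.
have iv (a c : R) : (@lebesgue_measure R).-integrable `[a, c] (EFin \o v).
  apply: continuous_compact_integrable => //; exact: segment_compact.
have mvs : measurable_fun setT (fun t : R => v (t - theta)).
  apply: (@measurableT_comp _ _ _ _ _ _ v) => //; exact: measurable_funB.
rewrite -(@Rintegral_itv_bndoo _ _ _ true false); last exact: measurable_funTS.
rewrite -[leRHS](@Rintegral_itv_bndoo _ _ _ true false); last exact: measurable_funTS.
have dF (x : R) : is_derive x 1 (fun t : R => t - theta) 1.
  by rewrite -[X in is_derive _ _ _ X]subr0; apply: is_deriveB.
have dF1 : (fun t : R => t - theta)^`()%classic = cst 1.
  by apply/funext => x; rewrite derive1E; exact: derive_val.
have -> : \int[@lebesgue_measure R]_(t in `[0, b]) v (t - theta) =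
    \int[@lebesgue_measure R]_(t in `[0 - theta, b - theta]) v t.
  rewrite /Rintegral; congr fine; apply/esym.
  rewrite (@integration_by_substitution_increasing R (fun t => t - theta))//.
  - by apply: eq_integral => x _; rewrite dF1 /= mulr1.
  - exact: ltW.
  - by move=> x y _ _ xy; rewrite ltrD2r.
  - by rewrite dF1 => x _; exact: cst_continuous.
  - by rewrite dF1; exact: is_cvg_cst.
  - by rewrite dF1; exact: is_cvg_cst.
  - split.
    + by move=> x _; exact: ex_derive.
    + by apply: cvg_at_right_filter; exact: (is_derive1_continuous (dF 0)).
    + by apply: cvg_at_left_filter; exact: (is_derive1_continuous (dF b)).
rewrite [leLHS]Rintegral_mkcond [leRHS]Rintegral_mkcond; apply: le_Rintegral => //.
- exact: integrable_patch.
- exact: integrable_patch.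
- move=> x _; rewrite !patchE; case: ifPn => [|_]; last by case: ifPn.
  rewrite inE/= in_itv/= => /andP[x1 x2].
  case: ifPn => //; rewrite notin_setE/= in_itv/= => /negP.
  rewrite negb_and -!ltNge => /orP[x0|bx]; first by rewrite vz// ltW.
  lra.
Qed.

(** One slice of the kernel: integrating the derivative over a window gives an
    increment of [Z], and at a point where [Z t > 0] one has
    [Z t - Z s >= max (Z t) 0 - max (Z s) 0].  Where [Z t <= 0] the
    increment of the positive part is at most 0. *)
Lemma positive_part_window_le (R : realType) (b theta z0 : R) (H : R -> R)
    (Z := primitive_oo z0 H)
    (P := [set t | 0 < t < b /\ 0 < Z t])
    (A := fun p : R * R => \1_P p.1 * (\1_(subdiag b) p *
       (\1_[set p : R * R | p.1 - p.2 < theta] p * H p.2))) :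
  0 < b -> 0 < theta -> z0 <= 0 ->
  (@lebesgue_measure R).-integrable setT (EFin \o H) ->
  (@lebesgue_measure R \x @lebesgue_measure R)%E.-integrable setT (EFin \o A) ->
  ((\int[@lebesgue_measure R]_(t in `]0, b[) Num.max (Z t) 0 -
    \int[@lebesgue_measure R]_(t in `]0, b[) Num.max (Z (t - theta)) 0)%:E <=
  \int[@lebesgue_measure R \x @lebesgue_measure R]_p (A p)%:E)%E.
Proof.
move=> b0 th0 z00 iH iA.
have Zc : continuous Z by exact: primitive_oo_continuous.
have Zle0 t : t <= 0 -> Z t = z0 by exact: primitive_oo_le0.
have Zsc : continuous (fun t => Z (t - theta)).
  move=> t; apply: (@continuous_comp _ _ _ (fun t => t - theta) Z t); last exact: Zc.
  by apply: cvgB; [exact: cvg_id|exact: cvg_cst].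
have vc (f : R -> R) : continuous f -> continuous (fun t => Num.max (f t) 0).
  by move=> fc t; apply: continuous_max; [exact: fc|exact: cvg_cst].
have iv := continuous_integrable_itv_oo 0 b (vc _ Zc).
have ivs := continuous_integrable_itv_oo 0 b (vc _ Zsc).
have ivv : (@lebesgue_measure R).-integrable `]0, b[
    (EFin \o (fun t => Num.max (Z t) 0 - Num.max (Z (t - theta)) 0)).
  by apply: continuous_integrable_itv_oo => t; apply: cvgB; [exact: vc|exact: (vc _ Zsc)].
rewrite -RintegralB// /Rintegral fineK; last exact: integrable_fin_num.
rewrite -(integral12_prod_meas1 iA) /fubini_F/=.
rewrite integral_mkcond; apply: le_integral => //.
- by rewrite -integrable_mkcond.
- exact: (integrable_fubini_F iA).
move=> t _.
pose lo := Num.max (t - theta) 0.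
have -> : (\int[@lebesgue_measure R]_s (A (t, s))%:E =
    (\1_P t * (Z t - Z (t - theta)))%:E)%E.
  rewrite /= indicE; case: (boolP (t \in P)) => [|tP]; last first.
    rewrite mul0r integral0_eq// => s _.
    by rewrite /A indicE (negbTE tP) mul0r.
  rewrite inE /P/= => -[/andP[t0 tb] Zt]; rewrite mul1r.
  have lot : lo < t by rewrite gt_max t0 andbT ltrBlDr ltrDl.
  have lo0 : 0 <= lo by rewrite le_max lexx orbT.
  have -> : Z t - Z (t - theta) = \int[@lebesgue_measure R]_(s in `]lo, t[) H s.
    have -> : Z (t - theta) = Z lo.
      by rewrite /lo; case: (leP (t - theta) 0) => // h; rewrite !Zle0.
    exact: primitive_ooB (ltW lot).
  rewrite /Rintegral fineK; last first.
    by apply: integrable_fin_num => //; apply: integrableS iH.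
  rewrite -integral_indicM; apply: eq_integral => s _.
  rewrite /A /= indicE mem_set ?mul1r; last by rewrite /P/= t0 tb.
  rewrite mulrA; congr ((_ * _)%:E).
  rewrite (_ : _ * _ =
    \1_(subdiag b `&` [set p : R * R | p.1 - p.2 < theta]) (t, s)); last by rewrite indicI.
  apply: eq_indic.
  rewrite /subdiag /= in_itv/= /lo gt_max; split.
    by move=> [[-> [-> _]] h]; rewrite !andbT; lra.
  by move=> /andP[/andP[h1 h2] h3]; split; [split; [lra|split]|lra].
rewrite patchE indicE; case: ifPn => [|tb].
  rewrite inE/= in_itv/= => tb.
  rewrite lee_fin; case: (boolP (t \in P)) => [|].
    rewrite inE => -[_ Zt]; rewrite mul1r (max_l (ltW Zt)).
    by rewrite lerB// le_max lexx.
  rewrite mul0r notin_setE/= => /not_andP[//|/negP]; rewrite -leNgt => Zt.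
  by rewrite (max_r Zt) sub0r oppr_le0 le_max lexx orbT.
rewrite memNset ?mul0r// => -[t0b _]; move: tb.
by rewrite notin_setE/= in_itv/= t0b.
Qed.

Lemma Rintegral_max0_gt0 (R : realType) (Z : R -> R) (b t1 : R) :
  continuous Z -> 0 < t1 <= b -> 0 < Z t1 ->
  0 < \int[@lebesgue_measure R]_(t in `]0, b[) Num.max (Z t) 0.
Proof.
move=> Zc /andP[t10 t1b] Zt1.
have vc : continuous (fun t => Num.max (Z t) 0).
  by move=> t; apply: continuous_max; [exact: Zc|exact: cvg_cst].
have iv := continuous_integrable_itv_oo 0 b vc.
have Zt12 : 0 < Z t1 / 2 by rewrite divr_gt0.
have /cvgrPdist_lt/(_ _ Zt12)/nbhs_ballP[e /= e0 he] : Z t @[t --> t1] --> Z t1.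
  exact: Zc.
pose t0 := Num.max 0 (t1 - e).
have t0t1 : t0 < t1 by rewrite gt_max t10 ltrBlDr ltrDl.
have sub : `]t0, t1[%classic `<=` `]0, b[%classic.
  move=> s; rewrite /= !in_itv/= gt_max => /andP[/andP[-> _] st].
  exact: lt_le_trans t1b.
apply: (@lt_le_trans _ _ ((Z t1 / 2) * (t1 - t0))).
  by rewrite mulr_gt0 ?divr_gt0 ?subr_gt0.
rewrite -lee_fin /Rintegral fineK; last exact: integrable_fin_num.
apply: (@le_trans _ _ (\int[@lebesgue_measure R]_(t in `]t0, t1[) (Num.max (Z t) 0)%:E)%E).
  apply: (@le_trans _ _ (\int[@lebesgue_measure R]_(t in `]t0, t1[) (Z t1 / 2)%:E)%E).
    by rewrite integral_cst//= lebesgue_measure_itv/= lte_fin t0t1 -EFinB.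
  apply: ge0_le_integral => //.
  - by move=> s _; rewrite lee_fin divr_ge0// ltW.
  - apply/measurable_EFinP; apply: measurable_funTS; exact: continuous_measurable_fun.
  - move=> s; rewrite /= in_itv/= gt_max => /andP[/andP[s0 es] st].
    rewrite lee_fin le_max; apply/orP; left.
    have : `|Z t1 - Z s| < Z t1 / 2.
      by apply: he; rewrite /ball/= gtr0_norm ?subr_gt0//; lra.
    by rewrite ltr_norml => /andP[h1 h2]; lra.
apply: ge0_subset_integral => //; first exact: measurable_int iv.
by move=> s _; rewrite lee_fin le_max lexx orbT.
Qed.

(** The integral of the Caputo derivative over the set where [z > 0] is
    nonpositive by hypothesis ([upper]), while slice by slice it dominates the
    integral [I] of the positive part ([lower]); so [I <= 0]. *)
Lemma caputo_max_principle_lt1 (R : realType) (alpha b : R) (h z : R -> R) :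
  0 < alpha < 1 -> 0 < b ->
  (@lebesgue_measure R).-integrable `]0, b[ (EFin \o h) ->
  (forall t, 0 <= t <= b -> z t = primitive_oo (z 0) h t) ->
  z 0 <= 0 ->
  {ae @lebesgue_measure R, forall t, 0 < t < b -> 0 < z t ->
     \int[@lebesgue_measure R]_(s in `]0, t[) ((t - s) `^ (- alpha) * h s) <= 0} ->
  forall t, 0 <= t <= b -> z t <= 0.
Proof.
move=> /andP[a0 a1] b0 ih zE z0 hz.
pose H := h \_ `]0, b[.
have iH : (@lebesgue_measure R).-integrable setT (EFin \o H) by exact: integrable_patch.
have mH : measurable_fun setT H by apply/measurable_EFinP; exact: measurable_int iH.
pose Z := primitive_oo (z 0) H.
have HE t s : t <= b -> s \in `]0, t[ -> H s = h s.
  move=> tb; rewrite in_itv/= => /andP[s0 st].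
  by rewrite /H patchE mem_set//= in_itv/= s0 (lt_le_trans st tb).
have ZE t : 0 <= t <= b -> Z t = z t.
  by move=> tb; rewrite (zE _ tb); apply: primitive_oo_patch; case/andP: tb.
have Zc : continuous Z by exact: primitive_oo_continuous.
have Zle0 t : t <= 0 -> Z t <= 0 by move=> ?; rewrite /Z primitive_oo_le0.
(* Off [P] the hypothesis says nothing, and the increments are discarded. *)
pose P : set R := [set t | 0 < t < b /\ 0 < Z t].
have mP : measurable P.
  have -> : P = `]0, b[%classic `&` [set t | 0 < Z t].
    by apply/seteqP; split=> t; rewrite /P/= in_itv/=.
  apply: measurableI => //; apply: measurable_set_lt => //.
  exact: continuous_measurable_fun.
pose A (p : R * R) := \1_P p.1 * (\1_(subdiag b) p * H p.2).
pose k (p : R * R) := (p.1 - p.2) `^ (- alpha).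
have mk : measurable_fun setT k by exact: measurable_diff_powR.
have mA : measurable_fun setT A.
  apply: measurable_funM.
    by apply: (@measurableT_comp _ _ _ _ _ _ (\1_P : R -> R)).
  apply: measurable_funM.
    exact: measurable_indic (measurable_subdiag b).
  exact: (@measurableT_comp _ _ _ _ _ _ H).
have ikA : (@lebesgue_measure R \x @lebesgue_measure R)%E.-integrable setT
    (fun p => (k p * A p)%:E).
  apply: le_integrable (kernel_integrable a1 b0 iH) => //.
    by apply/measurable_EFinP; exact: measurable_funM.
  move=> p _; rewrite /A/= lee_fin mulrCA !normrM.
  rewrite [leRHS](_ : _ = 1 * (`|k p| * (`|\1_(subdiag b) p| * `|H p.2|))); last first.
    by rewrite mul1r mulrCA.
  by rewrite ler_wpM2r ?mulr_ge0// indicE; case: (_ \in _); rewrite ?normr1 ?normr0.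
have k0 p : 0 <= k p by exact: powR_ge0.
have [iPsi PhiE] := @layer_cake_fubini _ _ R
  (product_sigma_finite (@lebesgue_measure R) (@lebesgue_measure R)) A k mA mk k0 ikA.
pose I := \int[@lebesgue_measure R]_(t in `]0, b[) Num.max (Z t) 0.
(* A window longer than [b] reaches below 0, where the positive part vanishes. *)
have lower c : ((\1_(`]0, b `^ (- alpha)[%classic : set R) c * I)%:E <=
    \int[@lebesgue_measure R \x @lebesgue_measure R]_p
      (\1_[set q : (R * R) * R | (0 < q.2 /\ q.2 < k q.1)%R] (p, c) * A p)%:E)%E.
  have [c0|c0] := leP c 0.
    rewrite indicE memNset ?mul0r; last by rewrite /= in_itv/= ltNge c0.
    rewrite integral0_eq// => p _; rewrite indicE memNset ?mul0r//=.
    by rewrite ltNge c0 => -[].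
  pose theta := c `^ (- alpha^-1).
  have th0 : 0 < theta by exact: powR_gt0.
  have e p : \1_[set q : (R * R) * R | (0 < q.2 /\ q.2 < k q.1)%R] (p, c) * A p =
     \1_P p.1 * (\1_(subdiag b) p * (\1_[set p : R * R| p.1 - p.2 < theta] p * H p.2)).
    rewrite /A; have [|ps] := boolP (p \in subdiag b); last first.
      by rewrite (indicE _ (subdiag b)) (negbTE ps) !mul0r !mulr0.
    rewrite inE => -[p0 [p21 pb]]; rewrite (indicE _ (subdiag b)) mem_set// !mul1r mulrCA.
    congr (_ * (_ * _)); apply: eq_indic; rewrite /= /k lt_powRN ?subr_gt0//.
    by split=> [[]|].
  under eq_integral do rewrite e.
  apply: le_trans (positive_part_window_le b0 th0 z0 iH _); last first.
    apply: le_integrable (integrableZl measurableT c^-1 ikA) => //.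
      apply/measurable_EFinP; apply: measurable_funM.
        by apply: (@measurableT_comp _ _ _ _ _ _ (\1_P : R -> R)).
      apply: measurable_funM; first exact: measurable_indic (measurable_subdiag b).
      apply: measurable_funM; last exact: (@measurableT_comp _ _ _ _ _ _ H).
      by apply: measurable_indic; apply: measurable_set_lt => //; exact: measurable_funB.
    move=> p _; rewrite /= -e lee_fin; move: (A p) => a.
    rewrite mulrA [leLHS]normrM [leRHS]normrM ler_wpM2r// normrM.
    rewrite (gtr0_norm (_ : 0 < c^-1)) ?invr_gt0// (ger0_norm (k0 p)).
    rewrite indicE; case: (boolP (_ \in _)) => [|_]; last by rewrite normr0 mulr_ge0 ?invr_ge0 ?k0// ltW.
    by rewrite inE/= normr1 => -[_ ck]; rewrite mulrC ler_pdivlMr// mul1r ltW.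
  rewrite lee_fin -/(Z _).
  have vc : continuous (fun t => Num.max (Z t) 0).
    by move=> t; apply: continuous_max; [exact: Zc|exact: cvg_cst].
  have := @Rintegral_shift_le R (fun t => Num.max (Z t) 0) b theta vc.
  move=> /(_ _ _ b0 th0) Ile.
  rewrite indicE; case: (boolP (_ \in _)) => [|_]; last first.
    rewrite mul0r subr_ge0; apply: Ile => t; first by rewrite le_max lexx orbT.
    by move=> /Zle0 /max_r.
  rewrite inE/= in_itv/= c0/= lt_powRN// -/theta mul1r => bth.
  rewrite [X in _ <= _ - X](_ : _ = 0) ?subr0//.
  rewrite /Rintegral integral0_eq// => t; rewrite /= in_itv/= => /andP[_ tb].
  by congr EFin; apply/max_r/Zle0; rewrite subr_le0 ltW// (lt_trans tb).
have upper : (\int[@lebesgue_measure R \x @lebesgue_measure R]_p (k p * A p)%:E <= 0)%E.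
  rewrite -(integral12_prod_meas1 ikA).
  set f := fubini_F _ _.
  have mf : measurable_fun setT f by exact: (measurable_fubini_F ikA).
  have f0 : {ae @lebesgue_measure R, forall t, setT t -> (f t <= 0)%E}.
    apply: ae_lebesgue_mp2 hz (kernel_ae_integrable a1 b0 ih) => t hzt it _.
    rewrite /f /fubini_F.
    have [|tP] := boolP (t \in P); last first.
      by rewrite integral0_eq// => s _; rewrite /A /= indicE (negbTE tP) mul0r mulr0.
    rewrite inE => -[tb Zt]; have /andP[t0 tb'] := tb.
    have zt : 0 < z t by rewrite -ZE// !ltW.
    have e s : k (t, s) * A (t, s) =
        \1_(`]0, t[%classic : set R) s * ((t - s) `^ (- alpha) * h s).
      rewrite /k /A /= indicE mem_set ?mul1r; last by split.
      rewrite mulrCA; have -> : \1_(subdiag b) (t, s) = \1_(`]0, t[%classic : set R) s :> R.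
        apply: eq_indic; rewrite /subdiag/= in_itv/=.
        by split=> [[-> [-> _]]//|/andP[-> ->]]; split.
      rewrite indicE; case: (boolP (_ \in _)) => [|_]; last by rewrite !mul0r.
      by rewrite inE => st; rewrite (HE t)// ltW.
    under eq_integral do rewrite e.
    rewrite integral_indicM -[leLHS]fineK; last by apply: integrable_fin_num => //; exact: it.
    by rewrite lee_fin; exact: hzt.
  exact: integral_ae_le0.
have : ((b `^ (- alpha) * I)%:E <= 0)%E.
  apply: le_trans upper; rewrite PhiE.
  apply: (@le_trans _ _ (\int[@lebesgue_measure R]_c
      (\1_(`]0, b `^ (- alpha)[%classic : set R) c * I)%:E)%E).
    rewrite integral_indicM integral_cst//= lebesgue_measure_itv/= lte_fin powR_gt0//.
    by rewrite -EFinB subr0 -EFinM mulrC.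
  apply: le_integral => //; last exact: (integrable_fubini_G iPsi).
  under eq_fun do rewrite EFinM muleC.
  apply: integrableZl => //; exact: (@integrable_indic_itv R 0 (b `^ (- alpha)) false true).
rewrite lee_fin pmulr_rle0 ?powR_gt0// => I0.
move=> t tb; rewrite leNgt; apply/negP => zt.
have /andP[t0 tb'] := tb.
have {}t0 : 0 < t.
  by rewrite lt_neqAle t0 andbT; apply/eqP => t0'; move: zt; rewrite -t0' ltNge z0.
suff : 0 < I by rewrite ltNge I0.
by apply: (@Rintegral_max0_gt0 _ _ _ t); rewrite ?ZE ?t0.
Qed.

(** * The maximum principle for the ordinary derivative *)

Lemma first_hitting (R : realType) (f : R -> R) (t1 : R) :
  continuous f -> 0 <= t1 -> f 0 < 0 -> 0 <= f t1 ->
  exists2 t0, 0 < t0 <= t1 & 0 <= f t0 /\ forall s, 0 <= s < t0 -> f s < 0.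
Proof.
move=> fc t10 f0 f1.
pose S : set R := [set t | 0 <= t <= t1 /\ 0 <= f t].
have St1 : S t1 by rewrite /S/= t10 lexx.
have S0 : lbound S 0 by move=> t [/andP[]].
have hiS : has_inf S by split; [exists t1|exists 0].
have [i0 i1] : 0 <= inf S /\ inf S <= t1.
  by split; [apply: lb_le_inf => //; exists t1|apply: ge_inf => //; exists 0].
have fi : 0 <= f (inf S).
  rewrite leNgt; apply/negP => fi.
  have fi' : 0 < - f (inf S) by rewrite oppr_gt0.
  have /cvgrPdist_lt/(_ _ fi')/nbhs_ballP[e /= e0 he] : f t @[t --> inf S] --> f (inf S).
    exact: fc.
  have [s Ss se] := inf_adherent e0 hiS.
  have is_ : inf S <= s by apply: ge_inf => //; exists 0.
  have : `|f (inf S) - f s| < - f (inf S).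
    by apply: he; rewrite /ball/= ler0_norm ?subr_le0//; lra.
  case: Ss => _ fs; rewrite ltr_norml => /andP[h1 h2]; lra.
exists (inf S); last first.
  split=> // s /andP[s0 si]; rewrite ltNge; apply/negP => fs.
  have : inf S <= s.
    by apply: ge_inf; [exists 0|split=> //; rewrite s0/= (le_trans (ltW si))].
  by rewrite leNgt si.
by rewrite i1 andbT lt_neqAle i0 andbT; apply/eqP => e; move: fi; rewrite -e leNgt f0.
Qed.

(** After the last time at which [z <= 0] the function cannot increase. *)
Lemma max_principle_derivative (R : realType) (b : R) (h z : R -> R) :
  0 < b -> (@lebesgue_measure R).-integrable `]0, b[ (EFin \o h) ->
  (forall t, 0 <= t <= b -> z t = primitive_oo (z 0) h t) ->
  z 0 <= 0 ->
  {ae @lebesgue_measure R, forall t, 0 < t < b -> 0 < z t -> h t <= 0} ->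
  forall t, 0 <= t <= b -> z t <= 0.
Proof.
move=> b0 ih zE z0 hz t1 /andP[t10 t1b]; rewrite leNgt; apply/negP => zt1.
pose H := h \_ `]0, b[.
have iH : (@lebesgue_measure R).-integrable setT (EFin \o H) by exact: integrable_patch.
pose Z := primitive_oo (z 0) H.
have HE t s : t <= b -> s \in `]0, t[ -> H s = h s.
  move=> tb; rewrite in_itv/= => /andP[s0 st].
  by rewrite /H patchE mem_set//= in_itv/= s0 (lt_le_trans st tb).
have ZE t : 0 <= t <= b -> Z t = z t.
  by move=> tb; rewrite (zE _ tb); apply: primitive_oo_patch; case/andP: tb.
have Zc : continuous Z by exact: primitive_oo_continuous.
(* In reversed time: the first [s] with [0 <= - Z (t1 - s)] marks the last
   time before [t1] at which [Z <= 0]. *)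
have gc : continuous (fun s => - Z (t1 - s)).
  move=> s; apply: cvgN; apply: (@continuous_comp _ _ _ (fun s => t1 - s) Z s); last exact: Zc.
  by apply: cvgB; [exact: cvg_cst|exact: cvg_id].
have [||s0 /andP[s00 s0t] [Zs0 Zpos]] := first_hitting gc t10.
- by rewrite subr0 ZE ?oppr_lt0// t10.
- by rewrite subrr ZE ?oppr_ge0// lexx ltW.
have [c0 ct] : 0 <= t1 - s0 /\ t1 - s0 < t1 by split; lra.
set c := t1 - s0 in c0 ct Zs0.
have Zle : \int[@lebesgue_measure R]_(s in `]c, t1[) H s <= 0.
  rewrite -lee_fin /Rintegral fineK; last first.
    by apply: integrable_fin_num => //; apply: integrableS iH.
  apply: integral_ae_le0 => //; first by apply: measurable_funTS; exact: measurable_int iH.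
  apply: ae_lebesgue_mp hz => t ht; rewrite /= in_itv/= => /andP[tc tt1].
  rewrite lee_fin (HE b)//; last first.
    by rewrite in_itv/= (le_lt_trans c0 tc) (lt_le_trans tt1).
  apply: ht; first by rewrite (le_lt_trans c0 tc) (lt_le_trans tt1).
  rewrite -ZE; last by rewrite !ltW ?(le_lt_trans c0 tc) ?(lt_le_trans tt1).
  have := Zpos (t1 - t); rewrite subKr oppr_lt0; apply.
  by rewrite /c in tc; apply/andP; split; lra.
have := primitive_ooB (z 0) iH c0 (ltW ct); rewrite -/Z.
rewrite oppr_ge0 in Zs0; move=> e; move: Zle; rewrite -e leNgt subr_gt0.
by rewrite (le_lt_trans Zs0)// ZE ?t10.
Qed.

(** * A slowly decaying supersolution *)

(** This is [(N / (t + N)) ^ alpha]: it starts at 1, and [N] is the time scale on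
    which it varies. *)
Definition decay (R : realType) (alpha N t : R) : R :=
  N `^ alpha * (t + N) `^ (- alpha).

Definition decay' (R : realType) (alpha N t : R) : R :=
  N `^ alpha * (- alpha * (t + N) `^ (- alpha - 1)).

Lemma is_derive_decay (R : realType) (alpha N t : R) : - N < t ->
  is_derive t 1 (decay alpha N) (decay' alpha N t).
Proof.
move=> Nt; have /= := is_deriveZ (N `^ alpha) (is_derive_powR_sub (- alpha) Nt).
by rewrite /GRing.scale/= /decay /decay' opprK.
Qed.

Lemma decay0 (R : realType) (alpha N : R) : 0 < N -> decay alpha N 0 = 1.
Proof.
by move=> N0; rewrite /decay add0r powRN mulfV// gt_eqF// powR_gt0.
Qed.

Lemma decay_gt0 (R : realType) (alpha N t : R) : 0 < N -> 0 <= t ->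
  0 < decay alpha N t.
Proof. by move=> N0 t0; rewrite mulr_gt0 ?powR_gt0//; lra. Qed.

Lemma decay'_le0 (R : realType) (alpha N t : R) : 0 <= alpha ->
  decay' alpha N t <= 0.
Proof. by move=> a0; rewrite /decay' mulNr mulrN oppr_le0 !mulr_ge0 ?powR_ge0. Qed.

Lemma decay_nonincreasing (R : realType) (alpha N s t : R) :
  0 <= alpha -> 0 < N -> 0 <= s -> s <= t -> decay alpha N t <= decay alpha N s.
Proof.
move=> a0 N0 s0 st; rewrite ler_pM2l ?powR_gt0// !powRN lef_pV2 ?posrE ?powR_gt0//; try lra.
by rewrite ge0_ler_powR ?nnegrE//; lra.
Qed.

Lemma decay_le1 (R : realType) (alpha N t : R) :
  0 <= alpha -> 0 < N -> 0 <= t -> decay alpha N t <= 1.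
Proof.
by move=> a0 N0 t0; rewrite -(decay0 alpha N0) decay_nonincreasing.
Qed.

(** The ratio of the two values is at most [1 + tau / N], because the exponent
    [alpha] is at most 1. *)
Lemma decay_delay (R : realType) (alpha N tau kappa s t : R) :
  0 <= alpha <= 1 -> 0 < N -> tau <= (kappa - 1) * N -> 1 <= kappa ->
  0 <= s -> s <= t -> t - tau <= s -> decay alpha N s <= kappa * decay alpha N t.
Proof.
move=> /andP[a0 a1] N0 tk k1 s0 st ts.
have sN : 0 < s + N by lra.
have tN : 0 < t + N by lra.
rewrite /decay mulrCA ler_pM2l ?powR_gt0// !powRN.
rewrite -[leLHS]mul1r ler_pdivrMr ?powR_gt0// mulrAC ler_pdivlMr ?powR_gt0// mul1r.
have -> : t + N = ((t + N) / (s + N)) * (s + N) by rewrite divfK ?gt_eqF.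
rewrite powRM ?divr_ge0 ?(ltW sN) ?(ltW tN)// ler_pM2r ?powR_gt0//.
have r1 : 1 <= (t + N) / (s + N) by rewrite ler_pdivlMr//; lra.
apply: le_trans (ler1_powR r1 a1) _; rewrite ler_pdivrMr//.
have : 0 <= (kappa - 1) * s by rewrite mulr_ge0//; lra.
lra.
Qed.

Lemma decay'_continuous (R : realType) (alpha N t : R) : - N < t ->
  {for t, continuous (decay' alpha N)}.
Proof.
move=> Nt; apply: (@is_derive1_continuous _ _ _
  (N `^ alpha * (- alpha * ((- alpha - 1) * (t + N) `^ (- alpha - 1 - 1))))).
have /= := is_deriveZ (N `^ alpha) (is_deriveZ (- alpha) (is_derive_powR_sub (- alpha - 1) Nt)).
by rewrite /GRing.scale/= /decay' opprK.
Qed.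

Lemma integrable_decay' (R : realType) (alpha N b : R) : 0 < N ->
  (@lebesgue_measure R).-integrable `]0, b[ (EFin \o decay' alpha N).
Proof.
move=> N0; have : (@lebesgue_measure R).-integrable `[0, b] (EFin \o decay' alpha N).
  apply: continuous_compact_integrable; first exact: segment_compact.
  apply: continuous_in_subspaceT => x; rewrite inE/= in_itv/= => /andP[x0 _].
  by apply: decay'_continuous; lra.
by apply: integrableS => //; exact: subset_itv_oo_cc.
Qed.

Lemma decay_primitive (R : realType) (alpha N t : R) : 0 < N -> 0 <= t ->
  decay alpha N t = primitive_oo 1 (decay' alpha N) t.
Proof.
move=> N0; rewrite le_eqVlt => /predU1P[<-|t0].
  by rewrite decay0// primitive_oo_le0.
rewrite /primitive_oo -(@Rintegral_itv_bndoo _ _ _ true false); last first.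
  apply/measurable_EFinP; exact: measurable_int (integrable_decay' alpha t N0).
have dx (x : R) : 0 <= x -> is_derive x 1 (decay alpha N) (decay' alpha N x).
  by move=> x0; apply: is_derive_decay; lra.
rewrite /Rintegral (@continuous_FTC2 _ _ (decay alpha N))//.
- by rewrite -EFinB/= decay0//; ring.
- apply: continuous_in_subspaceT => x; rewrite inE/= in_itv/= => /andP[x0 _].
  by apply: decay'_continuous; lra.
- split.
  + move=> x; rewrite in_itv/= => /andP[/ltW/dx h _]; exact: ex_derive.
  + by apply: cvg_at_right_filter; exact: (is_derive1_continuous (dx 0 (lexx 0))).
  + by apply: cvg_at_left_filter; exact: (is_derive1_continuous (dx t (ltW t0))).
- move=> x; rewrite in_itv/= => /andP[/ltW/dx h _].
  by rewrite derive1E; exact: derive_val.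
Qed.

Lemma decay_cvg0 (R : realType) (alpha N : R) : 0 < alpha -> 0 < N ->
  decay alpha N t @[t --> +oo] --> 0.
Proof.
move=> a0 N0; apply/cvgrPdist_lt => e e0.
pose M := (N `^ alpha / e) `^ (alpha^-1).
near=> t.
have t0 : 0 < t by near: t; exact: nbhs_pinfty_gt.
have tM : M < t by near: t; apply: nbhs_pinfty_gt; exact: num_real.
rewrite sub0r normrN gtr0_norm; last by rewrite decay_gt0// ltW.
rewrite /decay powRN ltr_pdivrMr ?powR_gt0//; last lra.
rewrite mulrC -ltr_pdivrMr//.
have -> : N `^ alpha / e = M `^ alpha.
  by rewrite /M -powRrM mulVf ?gt_eqF// powRr1// divr_ge0 ?powR_ge0 ?ltW.
rewrite gt0_ltr_powR ?nnegrE ?powR_ge0//; lra.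
Unshelve. all: by end_near. Qed.

Lemma decay'_ge (R : realType) (alpha N t : R) :
  0 <= alpha <= 1 -> 0 < N -> 0 <= t ->
  - (N^-1 * decay alpha N t) <= decay' alpha N t.
Proof.
move=> /andP[a0 a1] N0 t0; have tN : 0 < t + N by lra.
rewrite /decay' /decay mulrCA -mulrN ler_pM2l ?powR_gt0// mulNr lerN2.
have tNn0 : t + N != 0 by rewrite gt_eqF.
rewrite powRD ?tNn0 ?implybT// powR_inv1 ?(ltW tN)// mulrCA [_^-1 * _]mulrC.
rewrite [_ * (alpha * _)]mulrC [_ * N^-1]mulrC.
rewrite ler_pM2r ?powR_gt0// -[leRHS]mul1r ler_pM ?invr_ge0 ?(ltW tN)//.
by rewrite lef_pV2 ?posrE// lerDr.
Qed.

Lemma kernel_integrable_oo (R : realType) (alpha t : R) : alpha < 1 -> 0 <= t ->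
  (@lebesgue_measure R).-integrable `]0, t[ (fun s => ((t - s) `^ (- alpha))%:E) /\
  \int[@lebesgue_measure R]_(s in `]0, t[) (t - s) `^ (- alpha)
    <= (1 - alpha)^-1 * t `^ (1 - alpha).
Proof.
move=> a1 t0; have := integral_powR_subr_le a1 t0; rewrite subr0 => le.
have ik : (@lebesgue_measure R).-integrable `]0, t[ (fun s => ((t - s) `^ (- alpha))%:E).
  apply/integrableP; split.
    by apply/measurable_EFinP; apply: measurable_funTS; exact: measurable_kernel.
  under eq_integral do rewrite /= ger0_norm ?powR_ge0//.
  by apply: le_lt_trans le _; exact: ltry.
split=> //; rewrite -lee_fin /Rintegral fineK//; exact: integrable_fin_num.
Qed.

(** Either [s] is at distance at least [(t + N) / 2] from [t], and the kernel is
    small, or [s + N] is at least [(t + N) / 2], and the derivative is small. *)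
Lemma decay_kernel_le (R : realType) (alpha N s t : R) :
  0 <= alpha -> 0 < N -> 0 < s -> s < t ->
  (t - s) `^ (- alpha) * - decay' alpha N s <=
    ((t + N) / 2) `^ (- alpha) * - decay' alpha N s +
    N `^ alpha * (alpha * ((t + N) / 2) `^ (- alpha - 1)) * (t - s) `^ (- alpha).
Proof.
move=> a0 N0 s0 st.
have d0 : 0 <= - decay' alpha N s by rewrite oppr_ge0 decay'_le0.
have powRN_le x y c : 0 <= c -> 0 < x -> x <= y -> y `^ (- c) <= x `^ (- c) :> R.
  move=> c0 x0 xy; have y0 := lt_le_trans x0 xy.
  by rewrite !powRN lef_pV2 ?posrE ?powR_gt0// ge0_ler_powR ?nnegrE// ltW.
have [h|h] := leP ((t + N) / 2) (t - s).
  rewrite -[leLHS]addr0 lerD//; last by rewrite !mulr_ge0 ?powR_ge0.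
  by rewrite ler_wpM2r// powRN_le//; lra.
rewrite -[leLHS]add0r lerD//; first by rewrite mulr_ge0 ?powR_ge0.
rewrite mulrC ler_wpM2r ?powR_ge0// /decay' -mulrN mulNr opprK.
rewrite ler_wpM2l ?powR_ge0// ler_wpM2l//.
by rewrite -opprD powRN_le//; lra.
Qed.

(** The Caputo derivative of a power decaying at the rate [alpha] itself is of the
    same order as the function: the memory of the early decay contributes a
    multiple of [(t + N) ^ - alpha], which a faster power could not absorb.
    The factor [N ^ - alpha] comes from time scaling and makes the constant
    arbitrarily small. *)
Lemma decay_caputo_ge (R : realType) (alpha N t : R) :
  0 < alpha < 1 -> 0 < N -> 0 < t ->
  (@lebesgue_measure R).-integrable `]0, t[
    (fun s => ((t - s) `^ (- alpha) * decay' alpha N s)%:E) /\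
  - (10 / (1 - alpha) * N `^ (- alpha) * decay alpha N t) <=
  \int[@lebesgue_measure R]_(s in `]0, t[)
     ((t - s) `^ (- alpha) * decay' alpha N s).
Proof.
move=> /andP[a0 a1] N0 t0.
have [ik kle] := kernel_integrable_oo a1 (ltW t0).
have id := integrable_decay' alpha t N0.
set m := (t + N) / 2.
have m0 : 0 < m by rewrite /m; lra.
pose D := N `^ alpha * (alpha * m `^ (- alpha - 1)).
have D0 : 0 <= D by rewrite !mulr_ge0 ?powR_ge0// ltW.
have mkd : measurable_fun `]0, t[ (fun s => (t - s) `^ (- alpha) * decay' alpha N s).
  apply: measurable_funM; first by apply: measurable_funTS; exact: measurable_kernel.
  by apply/measurable_EFinP; exact: measurable_int id.
pose G s := m `^ (- alpha) * - decay' alpha N s + D * (t - s) `^ (- alpha).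
have idN : (@lebesgue_measure R).-integrable `]0, t[ (EFin \o (fun s => - decay' alpha N s)).
  exact: (integrableN id).
have i1 : (@lebesgue_measure R).-integrable `]0, t[
    (EFin \o (fun s => m `^ (- alpha) * - decay' alpha N s)).
  exact: (integrableZl _ (m `^ (- alpha)) idN).
have i2 : (@lebesgue_measure R).-integrable `]0, t[
    (EFin \o (fun s => D * (t - s) `^ (- alpha))).
  exact: (integrableZl _ D ik).
have iG : (@lebesgue_measure R).-integrable `]0, t[ (EFin \o G).
  exact: (integrableD _ i1 i2).
have le s : s \in `]0, t[ -> (t - s) `^ (- alpha) * - decay' alpha N s <= G s.
  by rewrite in_itv/= => /andP[s0 st]; apply: decay_kernel_le => //; exact: ltW.
have ikd : (@lebesgue_measure R).-integrable `]0, t[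
    (fun s => ((t - s) `^ (- alpha) * decay' alpha N s)%:E).
  apply: le_integrable iG => //; first exact/measurable_EFinP.
  move=> s st; rewrite /= lee_fin -normrN -mulrN ger0_norm; last first.
    by rewrite mulr_ge0 ?powR_ge0// oppr_ge0 decay'_le0 ?ltW.
  by apply: le_trans (le s st) _; exact: ler_norm.
have ikdN : (@lebesgue_measure R).-integrable `]0, t[
    (EFin \o (fun s => (t - s) `^ (- alpha) * - decay' alpha N s)).
  apply: (eq_integrable _ _ _ _ (integrableN ikd)) => // s _.
  by rewrite /= mulrN.
split=> //.
have -> : \int[@lebesgue_measure R]_(s in `]0, t[) ((t - s) `^ (- alpha) * decay' alpha N s) =
   - \int[@lebesgue_measure R]_(s in `]0, t[) ((t - s) `^ (- alpha) * - decay' alpha N s).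
  by rewrite -RintegralN//; apply: eq_Rintegral => s _; rewrite mulrN opprK.
rewrite lerN2.
apply: (@le_trans _ _ (\int[@lebesgue_measure R]_(s in `]0, t[) G s)).
  exact: le_Rintegral.
rewrite RintegralD// !RintegralZl//.
have -> : \int[@lebesgue_measure R]_(s in `]0, t[) - decay' alpha N s = 1 - decay alpha N t.
  rewrite (decay_primitive alpha N0 (ltW t0)) /primitive_oo.
  by rewrite RintegralN//; ring.
have U0 := decay_gt0 alpha N0 (ltW t0).
have U1 := decay_le1 (ltW a0) N0 (ltW t0).
set U := decay alpha N t in U0 U1 *.
have tN0 : 0 < t + N by lra.
(* Both terms are multiples of [X * U = (t + N) ^ - alpha], because
   [m ^ - alpha <= 2 * X * U]; the second one is quadratic in it, and
   [N ^ alpha] absorbs one factor. *)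
set X := N `^ (- alpha).
have X0 : 0 < X by rewrite powR_gt0.
have NX : N `^ alpha * X = 1 by rewrite /X powRN mulfV// gt_eqF// powR_gt0.
have Pt : (t + N) `^ (- alpha) = X * U by rewrite /U /decay mulrA [X * _]mulrC NX mul1r.
have h2 c : 0 <= c <= 1 -> (2 : R) `^ c <= 2.
  by move=> /andP[_ c1]; apply: ler1_powR => //; lra.
have mX : m `^ (- alpha) <= 2 * (X * U).
  have -> : m `^ (- alpha) = 2 `^ alpha * (t + N) `^ (- alpha).
    rewrite /m [_ / 2]mulrC powRM ?invr_ge0// ?(ltW tN0)//.
    by rewrite -(@powR_inv1 R 2)// -powRrM mulN1r opprK.
  rewrite Pt ler_pM2r; last exact: mulr_gt0.
  by apply: h2; rewrite !ltW.
set Y := m `^ (- alpha) in mX *; have Y0 : 0 <= Y by exact: powR_ge0.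
set K := (1 - alpha)^-1 in kle *.
have a1' : 0 < 1 - alpha by rewrite subr_gt0.
have K1 : 1 <= K by rewrite /K invf_ge1//; lra.
have NYY : N `^ alpha * (Y * Y) <= 4 * (X * U).
  have h : Y * Y <= (2 * (X * U)) * (2 * (X * U)) by rewrite ler_pM.
  apply: (@le_trans _ _ (N `^ alpha * ((2 * (X * U)) * (2 * (X * U))))).
    by rewrite ler_pM2l ?powR_gt0.
  have -> : N `^ alpha * ((2 * (X * U)) * (2 * (X * U))) =
      (N `^ alpha * X) * (4 * (X * U)) * U by ring.
  by rewrite NX mul1r ler_piMr// mulr_ge0// mulr_ge0// ltW.
have DJ : D * (\int[@lebesgue_measure R]_(s in `]0, t[) (t - s) `^ (- alpha)) <=
    K * (2 * (4 * (X * U))).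
  apply: (@le_trans _ _ (D * (K * (2 * m `^ (1 - alpha))))).
    apply: ler_wpM2l => //; apply: le_trans kle _; rewrite ler_pM2l ?invr_gt0//.
    apply: (@le_trans _ _ ((2 * m) `^ (1 - alpha))).
      have t2m : t <= 2 * m by rewrite /m mulrC divfK// lerDl ltW.
      have m20 : 0 <= 2 * m by apply: mulr_ge0 => //; exact: ltW.
      apply: ge0_ler_powR => //; rewrite ?nnegrE//; exact: ltW.
    rewrite powRM ?(ltW m0)// ler_wpM2r ?powR_ge0//.
    by apply: h2; rewrite (ltW a1') gerBl ltW.
  have -> : D * (K * (2 * m `^ (1 - alpha))) =
      alpha * (K * (2 * (N `^ alpha * (m `^ (- alpha - 1) * m `^ (1 - alpha))))).
    by rewrite /D; ring.
  have -> : m `^ (- alpha - 1) * m `^ (1 - alpha) = Y * Y.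
    have mn0 : m != 0 by rewrite gt_eqF.
    rewrite /Y -!powRD ?mn0 ?implybT//.
    by congr (_ `^ _); ring.
  rewrite -[leRHS]mul1r ler_pM ?(ltW a0) ?(ltW a1)//.
    by rewrite !mulr_ge0 ?powR_ge0// invr_ge0 ltW.
  by rewrite ler_pM2l ?invr_gt0// ler_pM2l.
have YU : Y * (1 - U) <= 2 * (X * U).
  by apply: le_trans mX; rewrite ler_piMr//; lra.
have XU : X * U <= K * (X * U) by rewrite ler_peMl// mulr_ge0// ltW.
have -> : 10 / (1 - alpha) * X * U = 2 * (K * (X * U)) + K * (2 * (4 * (X * U))).
  by rewrite -/K; ring.
rewrite lerD//; lra.
Qed.

(** * Comparison of delayed solutions with the supersolution *)

(** The Caputo derivative as a functional of the derivative alone, so that it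
    can be applied to multiples of it and to differences. *)
Definition caputo_of (R : realType) (alpha : R) (g : R -> R) (t : R) : R :=
  if alpha == 1 then g t
  else (Gamma (1 - alpha))^-1 *
       \int[@lebesgue_measure R]_(s in `]0, t[) ((t - s) `^ (- alpha) * g s).

(** What makes [decay alpha N] a supersolution of the equation with damping [mu]. *)
Definition slow_rate (R : realType) (alpha mu N : R) : Prop :=
  if alpha == 1 then N^-1 <= mu
  else 10 / (1 - alpha) * N `^ (- alpha) <= mu * Gamma (1 - alpha).

Lemma slow_rate_exists (R : realType) (alpha mu M : R) :
  0 < alpha <= 1 -> 0 < mu ->
  exists2 N : R, 0 < N /\ M <= N & slow_rate alpha mu N.
Proof.
move=> /andP[a0 a1] mu0; rewrite /slow_rate; case: eqVneq => [_|an1].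
  exists (Num.max M mu^-1); last first.
    by rewrite invf_ple ?posrE// ?lt_max ?invr_gt0 ?mu0 ?orbT// le_max lexx orbT.
  by split; [rewrite lt_max invr_gt0 mu0 orbT|rewrite le_max lexx].
have {an1}a1 : alpha < 1 by rewrite lt_neqAle an1.
have G0 : 0 < Gamma (1 - alpha) by apply: Gamma_gt0; rewrite a0.
have k0 : 0 < 10 / (1 - alpha) by rewrite divr_gt0// subr_gt0.
pose nu := mu * Gamma (1 - alpha) / (10 / (1 - alpha)).
have nu0 : 0 < nu by rewrite divr_gt0// mulr_gt0.
have N0 : 0 < Num.max M (nu `^ (- alpha^-1)) by rewrite lt_max powR_gt0 ?orbT.
exists (Num.max M (nu `^ (- alpha^-1))); first by rewrite N0 le_max lexx.
by rewrite mulrC -ler_pdivlMr// leNgt lt_powRN// -leNgt le_max lexx orbT.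
Qed.

(** The maximum principle applied to the difference of [y] and the
    supersolution. *)
Lemma decay_comparison (R : realType) (alpha mu N rho b : R) (g y : R -> R) :
  0 < alpha <= 1 -> 0 < N -> 0 < rho -> slow_rate alpha mu N -> 0 < b ->
  (@lebesgue_measure R).-integrable `]0, b[ (EFin \o g) ->
  (forall t, 0 <= t <= b -> y t = primitive_oo (y 0) g t) ->
  y 0 <= rho ->
  {ae @lebesgue_measure R, forall t, 0 < t < b -> rho * decay alpha N t < y t ->
     caputo_of alpha g t <= - (mu * (rho * decay alpha N t))} ->
  forall t, 0 <= t <= b -> y t <= rho * decay alpha N t.
Proof.
move=> /andP[a0 a1] N0 rho0 slow b0 ig yE y0 hy.
pose h t := g t - rho * decay' alpha N t.
pose z t := y t - rho * decay alpha N t.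
suff zle : forall t, 0 <= t <= b -> z t <= 0.
  by move=> t tb; rewrite -subr_le0; exact: zle.
have ird t : (@lebesgue_measure R).-integrable `]0, t[
    (EFin \o (fun s => rho * decay' alpha N s)).
  exact: (integrableZl _ rho (integrable_decay' alpha t N0)).
have ih : (@lebesgue_measure R).-integrable `]0, b[ (EFin \o h).
  exact: (integrableB _ ig (ird b)).
have igt t : t <= b -> (@lebesgue_measure R).-integrable `]0, t[ (EFin \o g).
  move=> tb; apply: integrableS ig => // s; rewrite /= !in_itv/= => /andP[-> st].
  exact: lt_le_trans tb.
have zE t : 0 <= t <= b -> z t = primitive_oo (z 0) h t.
  move=> tb; have /andP[t0 tb'] := tb.
  rewrite /primitive_oo /h RintegralB//; last exact: igt.
  rewrite RintegralZl//; last exact: integrable_decay'.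
  rewrite /z (yE _ tb) (decay_primitive alpha N0 t0) decay0// /primitive_oo.
  by ring.
have z0 : z 0 <= 0 by rewrite /z decay0// mulr1 subr_le0.
have [a1E|an1] := eqVneq alpha 1.
  apply: (max_principle_derivative b0 ih zE z0).
  apply: ae_lebesgue_mp hy => t ht tb zt; have /andP[t0 _] := tb.
  move: (ht tb); rewrite -subr_gt0 => /(_ zt).
  move: slow; rewrite /slow_rate /caputo_of a1E eqxx => slow gle.
  rewrite /h a1E subr_le0; apply: le_trans gle _.
  rewrite mulrCA -mulrN ler_pM2l//.
  apply: le_trans (@decay'_ge _ 1 N t _ N0 (ltW t0)); last by rewrite ler01 lexx.
  by rewrite lerN2 ler_pM2r// decay_gt0// ltW.
have {an1}an1 : alpha < 1 by rewrite lt_neqAle an1.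
have a01 : 0 < alpha < 1 by rewrite a0.
have G0 := Gamma_gt0 a01.
apply: (caputo_max_principle_lt1 a01 b0 ih zE z0).
apply: ae_lebesgue_mp2 hy (kernel_ae_integrable an1 b0 ig) => t ht it tb zt.
have /andP[t0 _] := tb.
move: (ht tb); rewrite -subr_gt0 => /(_ zt).
move: slow; rewrite /slow_rate /caputo_of (lt_eqF an1) => slow gle.
have [ikd kdge] := decay_caputo_ge a01 N0 t0.
have -> : \int[@lebesgue_measure R]_(s in `]0, t[) ((t - s) `^ (- alpha) * h s) =
  \int[@lebesgue_measure R]_(s in `]0, t[)
    ((t - s) `^ (- alpha) * g s - rho * ((t - s) `^ (- alpha) * decay' alpha N s)).
  by apply: eq_Rintegral => s _; rewrite /h; ring.
rewrite RintegralB//; [|exact: it|]; last first.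
  exact: (integrableZl _ rho ikd).
rewrite RintegralZl// subr_le0.
apply: (@le_trans _ _ (rho * - (10 / (1 - alpha) * N `^ (- alpha) * decay alpha N t))).
  move: gle; rewrite mulrC ler_pdivrMr// => gle; apply: le_trans gle _.
  have := decay_gt0 alpha N0 (ltW t0); move: (decay alpha N t) => U U0.
  have -> : - (mu * (rho * U)) * Gamma (1 - alpha) =
    rho * - (mu * Gamma (1 - alpha) * U) by ring.
  by rewrite ler_pM2l// lerN2 ler_pM2r.
by rewrite ler_pM2l.
Qed.

Lemma history_norm_lt (R : realType) (tau rho : R) (psi : R -> R) (s : R) :
  (history_norm tau psi < rho%:E)%E -> - tau <= s <= 0 -> `|psi s| < rho.
Proof.
move=> psir sI; rewrite -lte_fin; apply: le_lt_trans psir.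
by apply: ereal_sup_ubound; exists s => //; rewrite /= in_itv.
Qed.

Lemma caputoE (R : realType) (alpha t : R) (x : R -> R) :
  measurable_fun `]0, t[ (derive1 x) ->
  caputo alpha x t = caputo_of alpha (derive1 x) t.
Proof.
move=> mx; rewrite /caputo /caputo_of; case: ifP => // _; congr (_ * _).
apply: Rintegral_itv_bndoo; apply: measurable_funM => //.
by apply: measurable_funTS; exact: measurable_kernel.
Qed.

Lemma caputo_of_sign (R : realType) (alpha t : R) (b : bool) (g : R -> R) :
  (alpha != 1 -> (@lebesgue_measure R).-integrable `]0, t[
    (fun s => ((t - s) `^ (- alpha) * g s)%:E)) ->
  caputo_of alpha (fun s => (-1) ^+ b * g s) t = (-1) ^+ b * caputo_of alpha g t.
Proof.
move=> ikg; rewrite /caputo_of; case: ifPn => // /ikg {}ikg.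
rewrite [RHS]mulrCA; congr (_ * _); rewrite -RintegralZl//.
by apply: eq_Rintegral => s _; rewrite mulrCA.
Qed.

(** The sign [(-1) ^+ b] treats both sides of [c] at once.  The delayed value
    may exceed the current bound by one factor [kappa] for the tolerance and
    another one for the delay, whence [kappa ^+ 2]. *)
Definition sector (R : realType) (F : R -> R -> R) (c mu kappa r0 : R) : Prop :=
  forall (b : bool) (u y w : R), 0 < u <= r0 ->
    u <= (-1) ^+ b * y <= kappa * u -> `|w| <= kappa ^+ 2 * u ->
    (-1) ^+ b * F (c + y) (c + w) <= - (mu * u).

(** A continuity argument: up to the first time at which [x - c] reaches
    [kappa * rho * decay alpha N], the delayed value obeys the bound required by
    [sector], and comparison then gives the better bound without [kappa]. *)
Lemma solution_decay (R : realType) (alpha tau c mu kappa r0 N rho : R)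
    (F : R -> R -> R) (T : \bar R) (phi x : R -> R) :
  0 < alpha <= 1 -> 0 <= tau -> 1 < kappa -> 0 < N -> tau <= (kappa - 1) * N ->
  slow_rate alpha mu N -> 0 < rho <= r0 -> sector F c mu kappa r0 ->
  solution alpha tau F T phi x ->
  (history_norm tau (fun s => (phi s - c)%R) < rho%:E)%E ->
  forall t, 0 <= t -> (t%:E < T)%E -> `|x t - c| <= kappa * rho * decay alpha N t.
Proof.
move=> a01 tau0 k1 N0 tauN slow /andP[rho0 rhor] sec [xphi xprim xeq] hist.
move=> t1 t10 t1T; rewrite leNgt; apply/negP => big.
have /andP[a0 a1] := a01.
have k0 : 0 < kappa := lt_trans ltr01 k1.
have kr : rho < kappa * rho by rewrite ltr_pMl.
have past s : - tau <= s <= 0 -> `|x s - c| < rho.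
  by move=> sI; rewrite xphi//; exact: (history_norm_lt hist).
have x0 : `|x 0 - c| < rho by apply: past; rewrite lexx oppr_le0 tau0.
have {}t10 : 0 < t1.
  rewrite lt_neqAle t10 andbT; apply/eqP => t1E; move: big.
  by rewrite -t1E decay0// mulr1 ltNge (ltW (lt_trans x0 kr)).
have [_ ig xE] := xprim t1 t10 t1T.
set g := derive1 x in ig xE.
have igt t : t <= t1 -> (@lebesgue_measure R).-integrable `]0, t[ (EFin \o g).
  move=> tt1; apply: integrableS ig => // s; rewrite /= !in_itv/= => /andP[s0 st].
  by rewrite (ltW s0) (ltW (lt_le_trans st tt1)).
have mg t : t <= t1 -> measurable_fun `]0, t[ g.
  by move=> tt1; apply/measurable_EFinP; exact: measurable_int (igt _ tt1).
have xP t : 0 <= t <= t1 -> x t = primitive_oo (x 0) g t.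
  move=> tI; have /andP[_ tt1] := tI.
  by rewrite /primitive_oo -(@Rintegral_itv_bndoo _ _ _ true false _ (mg _ tt1)) -xE// addrC subrK.
pose X := primitive_oo (x 0) (g \_ `]0, t1[).
have Xc : continuous X.
  by apply: primitive_oo_continuous; apply: integrable_patch => //; exact: igt.
have XE t : 0 <= t <= t1 -> X t = x t.
  by move=> tI; rewrite (xP _ tI); apply: primitive_oo_patch; case/andP: tI.
pose f t := `|X t - c| - kappa * rho * decay alpha N (Num.max t 0).
have fc : continuous f.
  move=> t; apply: cvgB.
    by apply: cvg_norm; apply: cvgB; [exact: Xc|exact: cvg_cst].
  apply: cvgM; first exact: cvg_cst.
  apply: (@continuous_comp _ _ _ (fun t : R => Num.max t 0) (decay alpha N) t).
    by apply: continuous_max; [exact: cvg_id|exact: cvg_cst].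
  apply: (is_derive1_continuous (is_derive_decay alpha _)).
  by rewrite lt_max; apply/orP; right; rewrite oppr_lt0.
have [||t0 /andP[t00 t0t1] [ft0 flt]] := first_hitting fc (ltW t10).
- by rewrite /f XE ?lexx ?(ltW t10)// maxxx decay0// mulr1 subr_lt0 (lt_trans x0 kr).
- by rewrite /f XE ?lexx ?(ltW t10)// max_l ?(ltW t10)// subr_ge0 ltW.
(* Covers the history as well, since the bound at 0 exceeds [rho]. *)
have before s : - tau <= s -> s < t0 ->
    `|x s - c| <= kappa * rho * decay alpha N (Num.max s 0).
  move=> taus st0; have [s0|s0] := leP s 0.
    by rewrite decay0// mulr1 ltW// (lt_trans _ kr)// past// taus.
  have := flt s; rewrite (ltW s0) st0 /f (max_l (ltW s0)) => /(_ isT).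
  by rewrite subr_lt0 XE ?(ltW s0) ?(ltW (lt_le_trans st0 t0t1))// => /ltW.
(* The comparison applies to both signs and improves [kappa * rho] to [rho]. *)
have half (b : bool) : (-1) ^+ b * (x t0 - c) <= rho * decay alpha N t0.
  pose y t := (-1) ^+ b * (x t - c).
  have igb : (@lebesgue_measure R).-integrable `]0, t0[ (EFin \o (fun s => (-1) ^+ b * g s)).
    exact: (integrableZl _ ((-1) ^+ b) (igt _ t0t1)).
  apply: (@decay_comparison _ _ _ _ _ _ _ y a01 N0 rho0 slow t00 igb).
  - move=> t /andP[t_0 tt0]; have tt1 := le_trans tt0 t0t1.
    rewrite /y /primitive_oo RintegralZl//; last exact: igt.
    by rewrite (xP t) ?t_0// /primitive_oo; ring.
  - rewrite /y; apply: le_trans (ltW x0); apply: le_trans (ler_norm _) _.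
    by rewrite normrM normr_sign mul1r.
  - have aeint : {ae @lebesgue_measure R, forall t, 0 < t < t0 -> alpha != 1 ->
        (@lebesgue_measure R).-integrable `]0, t[
          (fun s => ((t - s) `^ (- alpha) * g s)%:E)}.
      have [a1E|an1] := eqVneq alpha 1.
        by apply: (ae_lebesgue_mp _ xeq) => t _ _.
      have alt1 : alpha < 1 by rewrite lt_neqAle an1.
      by apply: ae_lebesgue_mp (kernel_ae_integrable alt1 t00 (igt _ t0t1)) => t it /it.
    apply: ae_lebesgue_mp2 xeq aeint => t xt it tt0 uy.
    have /andP[t_0 ltt0] := tt0; have tt1 := ltW (lt_le_trans ltt0 t0t1).
    have dt : 0 < decay alpha N t by rewrite decay_gt0// ltW.
    have tT : (t%:E < T)%E by apply: le_lt_trans t1T; rewrite lee_fin.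
    rewrite caputo_of_sign; last exact: it.
    rewrite -(caputoE _ (mg _ tt1)) xt//.
    have := sec b (rho * decay alpha N t) (x t - c) (x (t - tau) - c).
    rewrite ![c + (_ - c)]addrC !subrK; apply.
    + rewrite mulr_gt0//=; apply: le_trans rhor.
      by rewrite ler_piMr ?(ltW rho0)// decay_le1// ltW.
    + rewrite (ltW uy)/=; apply: le_trans (ler_norm _) _.
      rewrite normrM normr_sign mul1r mulrA -[X in decay _ _ X](max_l (ltW t_0)).
      by apply: before => //; rewrite (le_trans _ (ltW t_0))// oppr_le0.
    + apply: le_trans (before _ _ _) _; first by rewrite lerBrDl subrr ltW.
        by rewrite (le_lt_trans _ ltt0)// gerBl.
      have -> : kappa ^+ 2 * (rho * decay alpha N t) =
        kappa * rho * (kappa * decay alpha N t) by ring.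
      rewrite ler_pM2l ?mulr_gt0//; apply: (@decay_delay _ _ _ tau) => //.
      * by rewrite (ltW a0).
      * exact: ltW.
      * by rewrite le_max lexx orbT.
      * by rewrite ge_max (ltW t_0) andbT gerBl.
      * by rewrite le_max lexx.
  - by rewrite lexx (ltW t00).
have dt0 : 0 < decay alpha N t0 by rewrite decay_gt0// ltW.
move: ft0; rewrite /f XE ?(ltW t00)// (max_l (ltW t00)) subr_ge0 leNgt => /negP; apply.
apply: (@le_lt_trans _ _ (rho * decay alpha N t0)); last by rewrite ltr_pM2r.
rewrite ler_norml; have := half true; have := half false.
rewrite expr0 expr1 mul1r mulN1r => h1 h2; rewrite h1 andbT; lra.
Qed.

Lemma equilibrium_cst (R : realType) (alpha tau c : R) (F : R -> R -> R) :
  F c c = 0 -> equilibrium alpha tau F c.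
Proof.
move=> Fc.
have d0 : derive1 (cst c : R -> R) = cst 0.
  by apply/funext => t; rewrite derive1E; exact: derive_val.
have I0 (D : set R) : \int[@lebesgue_measure R]_(s in D) (cst 0 s : R) = 0.
  by rewrite /Rintegral integral0_eq.
split=> // [b b0 _|].
- split=> [||t _].
  + by apply: aeW => t _; exact: derivable_cst.
  + by rewrite d0; exact: integrable0.
  + by rewrite d0 I0 subrr.
- apply: aeW => t _ _; rewrite Fc /caputo d0; case: ifP => // _.
  rewrite (_ : (fun s : R => _) = cst 0) ?I0 ?mulr0//.
  by apply/funext => s; rewrite mulr0.
Qed.

(** Both requirements come from the one bound of [solution_decay]: a small [rho]
    gives stability, and [t] tending to infinity gives attraction. *)
Lemma sector_asymptotically_stable (R : realType) (alpha tau c mu kappa r0 : R)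
    (F : R -> R -> R) :
  0 < alpha <= 1 -> 0 <= tau -> 0 < mu -> 1 < kappa -> 0 < r0 ->
  sector F c mu kappa r0 -> F c c = 0 -> asymptotically_stable alpha tau F c.
Proof.
move=> a01 tau0 mu0 k1 r00 sec Fc.
have /andP[a0 a1] := a01.
have k10 : 0 < kappa - 1 by rewrite subr_gt0.
have k0 : 0 < kappa := lt_trans ltr01 k1.
have [N [N0 tauN] slow] := slow_rate_exists (tau / (kappa - 1)) a01 mu0.
rewrite ler_pdivrMr// mulrC in tauN.
split; [split; first exact: equilibrium_cst|].
- move=> eta eta0; pose rho := Num.min r0 (eta / (2 * kappa)).
  have rho0 : 0 < rho by rewrite lt_min r00 divr_gt0// mulr_gt0.
  have rhor : 0 < rho <= r0 by rewrite rho0 ge_min lexx.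
  exists rho => // T phi x sol hist t t0 tT.
  apply: le_lt_trans (solution_decay a01 tau0 k1 N0 tauN slow rhor sec sol hist t0 tT) _.
  apply: (@le_lt_trans _ _ (kappa * rho)).
    by rewrite ler_piMr ?mulr_ge0 ?(ltW k0) ?(ltW rho0)// decay_le1// ltW.
  apply: (@le_lt_trans _ _ (kappa * (eta / (2 * kappa)))).
    by rewrite ler_pM2l// ge_min lexx orbT.
  have -> : kappa * (eta / (2 * kappa)) = eta / 2 by field; rewrite gt_eqF.
  lra.
- exists r0 => // phi x sol hist.
  have r0r : 0 < r0 <= r0 by rewrite r00 lexx.
  have lim : kappa * r0 * decay alpha N t @[t --> +oo] --> 0.
    by rewrite -(mulr0 (kappa * r0)); apply: cvgM; [exact: cvg_cst|exact: decay_cvg0].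
  apply/cvgrPdist_lt => e e0.
  move/cvgrPdist_lt: lim => /(_ _ e0) lim.
  near=> t.
  have t0 : 0 <= t by near: t; exact: nbhs_pinfty_ge.
  have := solution_decay a01 tau0 k1 N0 tauN slow r0r sec sol hist t0 (ltry t).
  rewrite distrC => h; apply: le_lt_trans h _.
  have : `|0 - kappa * r0 * decay alpha N t| < e by near: t; exact: lim.
  by rewrite sub0r normrN; apply: le_lt_trans; exact: ler_norm.
Unshelve. all: by end_near. Qed.

(** * The cubic delay equation *)

(** The strict gap [- b - |a|] leaves room both for a factor [kappa ^ 2] above 1
    on the delayed term and, for small [u], for the nonlinear terms. *)
Lemma sector_bound (R : realType) (eps p c a b : R) :
  0 < eps -> 0 < p -> 0 < c -> `|a| < - b ->
  exists mu kappa r0 : R, [/\ 0 < mu, 1 < kappa, 0 < r0 &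
    forall u y w : R, 0 < u <= r0 -> u <= y <= kappa * u ->
      `|w| <= kappa ^+ 2 * u ->
      `|a * w| + 3 * eps * c * w ^+ 2 + eps * `|w| ^+ 3 + b * y + p * y ^+ 2
        <= - (mu * u)].
Proof.
move=> e0 p0 c0 ab.
pose g := - b - `|a|.
have g0 : 0 < g by rewrite subr_gt0.
have na := normr_ge0 a.
(* A quarter of the gap [g] pays for [kappa ^ 2 - 1 <= 3 * eta], a quarter for
   the terms of order two and three, all at most [C * u ^ 2]. *)
pose eta := Num.min 1 (g / (12 * (`|a| + 1))).
have den : 0 < 12 * (`|a| + 1) by lra.
have eta0 : 0 < eta by rewrite lt_min ltr01 divr_gt0.
have eta1 : eta <= 1 by rewrite ge_min lexx.
have etag : eta * (12 * (`|a| + 1)) <= g.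
  by rewrite -ler_pdivlMr// ge_min lexx orbT.
pose C := 48 * eps * c + 64 * eps + 4 * p.
have ec0 : 0 < eps * c by rewrite mulr_gt0.
have C0 : 0 < C by rewrite /C -!mulrA; lra.
pose r0 := Num.min 1 (g / (4 * C)).
have r00 : 0 < r0 by rewrite lt_min ltr01 divr_gt0// mulr_gt0.
have r01 : r0 <= 1 by rewrite ge_min lexx.
have r0g : r0 * (4 * C) <= g.
  by rewrite -ler_pdivlMr ?mulr_gt0// ge_min lexx orbT.
exists (g / 2), (1 + eta), r0; split; rewrite ?divr_gt0// ?ltrDl//.
move=> u y w /andP[u0 ur] /andP[uy yk] wk.
have u1 : u <= 1 by apply: le_trans ur _.
have w0 := normr_ge0 w.
have k2 : (1 + eta) ^+ 2 <= 1 + 3 * eta.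
  have : eta * eta <= eta by rewrite ler_piMl// ltW.
  by rewrite expr2; lra.
have wk2 : `|w| <= (1 + 3 * eta) * u by apply: le_trans wk _; rewrite ler_pM2r.
have w4 : `|w| <= 4 * u.
  by apply: le_trans wk2 _; rewrite ler_pM2r//; lra.
have y2 : y <= 2 * u by apply: le_trans yk _; rewrite ler_pM2r//; lra.
have b0 : b < 0 by lra.
have h1 : `|a * w| <= (`|a| + g / 4) * u.
  rewrite normrM; apply: (@le_trans _ _ (`|a| * ((1 + 3 * eta) * u))).
    by rewrite ler_wpM2l.
  rewrite mulrA ler_pM2r// mulrDr mulr1 lerD2l.
  have : `|a| * eta <= eta * (`|a| + 1) by rewrite mulrC ler_pM2l//; lra.
  lra.
have h2 : b * y <= b * u by rewrite ler_nM2l.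
have uu0 : 0 < u * u by rewrite mulr_gt0.
have h3 : w ^+ 2 <= 16 * (u * u).
  rewrite -real_normK ?num_real// expr2.
  have := ler_pM w0 w0 w4 w4; lra.
have h4 : `|w| ^+ 3 <= 64 * (u * u).
  rewrite -real_normK ?num_real// in h3; rewrite exprS.
  have h : `|w| <= 4 by lra.
  have := ler_pM w0 (sqr_ge0 `|w|) h h3; lra.
have h5 : y ^+ 2 <= 4 * (u * u).
  have y0 : 0 <= y by lra.
  by rewrite expr2; have := ler_pM y0 y0 y2 y2; lra.
have h3' : 3 * eps * c * w ^+ 2 <= 48 * (eps * c) * (u * u).
  rewrite -!mulrA; have : (eps * c) * w ^+ 2 <= (eps * c) * (16 * (u * u)) by rewrite ler_pM2l.
  lra.
have h4' : eps * `|w| ^+ 3 <= 64 * eps * (u * u).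
  have : eps * `|w| ^+ 3 <= eps * (64 * (u * u)) by rewrite ler_pM2l.
  lra.
have h5' : p * y ^+ 2 <= 4 * p * (u * u).
  have : p * y ^+ 2 <= p * (4 * (u * u)) by rewrite ler_pM2l.
  lra.
have h6 : C * (u * u) <= g / 4 * u.
  rewrite mulrA ler_pM2r//.
  have : u * (4 * C) <= r0 * (4 * C) by rewrite ler_pM2r// mulr_gt0.
  lra.
have h7 : C * (u * u) = 48 * (eps * c) * (u * u) + 64 * eps * (u * u) + 4 * p * (u * u).
  by rewrite /C; ring.
have h8 : - (g / 2 * u) = (`|a| + g / 4) * u + b * u + g / 4 * u.
  by rewrite /g; field.
rewrite h8; lra.
Qed.

Theorem theorem5 (R : realType) (alpha delta epsilon p q : R)
    (halpha : 0 < alpha <= 1)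
    (hepsilon : 0 < epsilon) (hp : 0 < p)
    (hq : 0 < - q) (hqdelta : - q < delta) (hdelta : delta < - 2 * q)
    (tau : R) (htau : 0 <= tau) :
  asymptotically_stable alpha tau
    (fun xt xd : R =>
       delta * xd - epsilon * xd ^+ 3 - p * xt ^+ 2 + q * xt)
    ((- p + Num.sqrt (p ^+ 2 + 4 * epsilon * (delta + q))) / (2 * epsilon)).
Proof.
set S := Num.sqrt _; set c := (- p + S) / (2 * epsilon).
have dq0 : 0 < delta + q by lra.
have D0 : 0 < 4 * epsilon * (delta + q) by rewrite !mulr_gt0.
have Sp : p < S.
  rewrite -(ger0_norm (ltW hp)) -sqrtr_sqr ltr_sqrt; last exact: ltr_wpDl (sqr_ge0 _) D0.
  by rewrite ltrDl.
have c0 : 0 < c by rewrite divr_gt0 ?mulr_gt0//; lra.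
have cE : epsilon * c ^+ 2 + p * c = delta + q.
  have S2 : S ^+ 2 = p ^+ 2 + 4 * epsilon * (delta + q).
    by rewrite sqr_sqrtr// addr_ge0 ?sqr_ge0// ltW.
  have SE : S = 2 * epsilon * c + p by rewrite /c; field; rewrite gt_eqF.
  have : 4 * epsilon * (epsilon * c ^+ 2 + p * c) = 4 * epsilon * (delta + q).
    by move: S2; rewrite SE => S2; apply: (addrI (p ^+ 2)); rewrite -S2; ring.
  by apply: mulfI; rewrite mulf_neq0// gt_eqF.
clearbody c.
pose a := delta - 3 * epsilon * c ^+ 2.
pose b := q - 2 * p * c.
have pc0 : 0 < p * c by rewrite mulr_gt0.
have ec0 : 0 < epsilon * c ^+ 2 by rewrite mulr_gt0// exprn_gt0.
(* [cE] turns [- b - a] into [2 epsilon c ^ 2 + p c] and [a - b] into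
   [- 4 q - 2 delta + 5 p c]. *)
have ab : `|a| < - b by rewrite ltr_norml /a /b -!mulrA; apply/andP; split; lra.
have [mu [kappa [r0 [mu0 k1 r00 bnd]]]] := sector_bound hepsilon hp c0 ab.
apply: (@sector_asymptotically_stable _ _ _ _ mu kappa r0) => //; last first.
  have -> : delta * c - epsilon * c ^+ 3 - p * c ^+ 2 + q * c =
    c * (delta + q - (epsilon * c ^+ 2 + p * c)) by ring.
  by rewrite cE subrr mulr0.
move=> s u y w uI yI wI.
have FE : delta * (c + w) - epsilon * (c + w) ^+ 3 - p * (c + y) ^+ 2 + q * (c + y) =
    a * w - 3 * epsilon * c * w ^+ 2 - epsilon * w ^+ 3 + b * y - p * y ^+ 2.
  transitivity (c * (delta + q - (epsilon * c ^+ 2 + p * c)) +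
    (a * w - 3 * epsilon * c * w ^+ 2 - epsilon * w ^+ 3 + b * y - p * y ^+ 2)).
    by rewrite /a /b; ring.
  by rewrite cE subrr mulr0 add0r.
rewrite FE; apply: le_trans (bnd u ((-1) ^+ s * y) w uI yI wI).
have h1 : (-1) ^+ s * (a * w) <= `|a * w|.
  by apply: le_trans (ler_norm _) _; rewrite normrM normr_sign mul1r.
have h2 : (-1) ^+ s * - (3 * epsilon * c * w ^+ 2) <= 3 * epsilon * c * w ^+ 2.
  apply: le_trans (ler_norm _) _; rewrite normrM normr_sign mul1r normrN ger0_norm//.
  apply: mulr_ge0; last exact: sqr_ge0.
  apply: ltW; rewrite !mulr_gt0//.
have h3 : (-1) ^+ s * - (epsilon * w ^+ 3) <= epsilon * `|w| ^+ 3.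
  apply: le_trans (ler_norm _) _.
  by rewrite normrM normr_sign mul1r normrN normrM normrX (gtr0_norm hepsilon).
have h4 : (-1) ^+ s * - (p * y ^+ 2) <= p * ((-1) ^+ s * y) ^+ 2.
  rewrite exprMn sqrr_sign mul1r.
  apply: le_trans (ler_norm _) _; rewrite normrM normr_sign mul1r normrN ger0_norm//.
  by rewrite mulr_ge0 ?sqr_ge0 ?(ltW hp).
(* Only the damping term keeps its sign; the others are bounded by size. *)
have -> : (-1) ^+ s * (a * w - 3 * epsilon * c * w ^+ 2 - epsilon * w ^+ 3 +
      b * y - p * y ^+ 2) =
    (-1) ^+ s * (a * w) + (-1) ^+ s * - (3 * epsilon * c * w ^+ 2) +
    (-1) ^+ s * - (epsilon * w ^+ 3) + b * ((-1) ^+ s * y) +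
    (-1) ^+ s * - (p * y ^+ 2) by ring.
by apply: lerD => //; apply: lerD => //; apply: lerD => //; apply: lerD.
Qed.
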